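(* Let $n\ge 3$, $1\le p\le\infty$, $\alpha\ge 0$, $\beta>(n-1)(p-1)/p$ (that is, $\beta>n-1$ if $p=\infty$), let $k$ be a real constant, and for $f\in L^p(\mathbb{R}^{n-1})$ let $$u(x)=k\int_{\mathbb{R}^{n-1}}\left(\frac{x_n^{\alpha}}{|y-x|}\right)^{\beta} f(y')\,dy',\qquad x\in\mathbb{R}^n_+,\ y=(y',0).$$ Let $x$ be an arbitrary point in $\mathbb{R}^n_+$ and let $\boldsymbol z\in\mathbb{S}^{n-1}$. The sharp coefficient $\mathcal{C}_{\alpha,\beta,p}(x;\boldsymbol z)$ in the inequality $$|(\nabla u(x),\boldsymbol z)|\le \mathcal{C}_{\alpha,\beta,p}(x;\boldsymbol z)\,\|f\|_p$$ is given by $$\mathcal{C}_{\alpha,\beta,p}(x;\boldsymbol z)=\frac{C_{\alpha,\beta,p}(\boldsymbol z)}{x_n^{\,2-n+\beta(1-\alpha)+((n-1)/p)}},$$ where $$C_{\alpha,\beta,1}(\boldsymbol z)=|k|\beta\sup_{\sigma\in\mathbb{S}^{n-1}_+}\big|\big(\alpha\boldsymbol e_n-(\boldsymbol e_\sigma,\boldsymbol e_n)\boldsymbol e_\sigma,\ \boldsymbol z\big)\big|\,(\boldsymbol e_\sigma,\boldsymbol e_n)^{\beta},$$ $$C_{\alpha,\beta,p}(\boldsymbol z)=|k|\beta\left\{\int_{\mathbb{S}^{n-1}_+}\big|\big(\alpha\boldsymbol e_n-(\boldsymbol e_\sigma,\boldsymbol e_n)\boldsymbol e_\sigma,\ \boldsymbol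 z\big)\big|^{\frac{p}{p-1}}(\boldsymbol e_\sigma,\boldsymbol e_n)^{\frac{(\beta-n)p+n}{p-1}}\,d\sigma\right\}^{\frac{p-1}{p}}$$ for $1<p<\infty$, and $$C_{\alpha,\beta,\infty}(\boldsymbol z)=|k|\beta\int_{\mathbb{S}^{n-1}_+}\big|\big(\alpha\boldsymbol e_n-(\boldsymbol e_\sigma,\boldsymbol e_n)\boldsymbol e_\sigma,\ \boldsymbol z\big)\big|\,(\boldsymbol e_\sigma,\boldsymbol e_n)^{\beta-n}\,d\sigma.$$ In particular, the sharp coefficient $\mathcal{C}_{\alpha,\beta,p}(x)$ in the inequality $$|\nabla u(x)|\le\mathcal{C}_{\alpha,\beta,p}(x)\,\|f\|_p$$ is given by $$\mathcal{C}_{\alpha,\beta,p}(x)=\frac{C_{\alpha,\beta,p}}{x_n^{\,2-n+\beta(1-\alpha)+((n-1)/p)}},\qquad C_{\alpha,\beta,p}=\sup_{|\boldsymbol z|=1}C_{\alpha,\beta,p}(\boldsymbol z).$$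
   Context: $\mathbb{R}^n_+=\{x=(x',x_n):x'\in\mathbb{R}^{n-1},\ x_n>0\}$; $\mathbb{S}^{n-1}=\{x\in\mathbb{R}^n:|x|=1\}$; $\mathbb{S}^{n-1}_+=\{x\in\mathbb{S}^{n-1}:x_n>0\}$; $d\sigma$ is surface measure on $\mathbb{S}^{n-1}$. $\boldsymbol e_\sigma$ is the unit vector from the origin to the point $\sigma\in\mathbb{S}^{n-1}$, $\boldsymbol e_n$ is the unit vector of the $n$-th coordinate axis, $(\cdot,\cdot)$ is the Euclidean inner product. $\|\cdot\|_p$ is the norm of $L^p(\mathbb{R}^{n-1})$ (real-valued functions). For $p=\infty$, $(n-1)/p$ is read as $0$ and $(p-1)/p$ as $1$. ''Sharp coefficient'' at a given $x$ means the smallest constant for which the inequality holds for all $f\in L^p(\mathbb{R}^{n-1})$. *)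

(* Defs.v *)
From HB Require Import structures.
From mathcomp Require Import all_boot all_order all_algebra.
From mathcomp Require Import all_classical all_reals all_analysis.
From mathcomp Require Import measurable_realfun.

Set Implicit Arguments.
Unset Strict Implicit.
Unset Printing Implicit Defensive.
Import Order.TTheory GRing.Theory Num.Theory.
Import numFieldNormedType.Exports.

Local Open Scope classical_set_scope.
Local Open Scope ring_scope.

(* R^n is 'rV[R]_n; its sigma-algebra is the one generated by the coordinates,
   i.e. the Borel one. *)
Section measurable_rV.
Variables (R : realType) (n : nat).

Let coord (i : 'I_n) (x : 'rV[R]_n) : R := x ord0 i.

Let rV_set0 : g_sigma_preimage coord set0.
Proof. exact: sigma_algebra0. Qed.

Let rV_setC A : g_sigma_preimage coord A -> g_sigma_preimage coord (~` A).
Proof. exact: sigma_algebraC. Qed.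

Let rV_bigcup (F : _^nat) : (forall i, g_sigma_preimage coord (F i)) ->
  g_sigma_preimage coord (\bigcup_i (F i)).
Proof. exact: sigma_algebra_bigcup. Qed.

HB.instance Definition _ :=
  @isMeasurable.Build (measure_tuple_display default_measure_display) 'rV[R]_n
    (g_sigma_preimage coord) rV_set0 rV_setC rV_bigcup.

End measurable_rV.

Lemma measurable_coord (R : realType) n (i : 'I_n) :
  measurable_fun setT (fun x : 'rV[R]_n => x ord0 i).
Proof.
move=> _ Y mY; rewrite setTI; apply: sub_sigma_algebra => /=.
rewrite -bigcup_seq/=; exists i => /=; first by rewrite mem_index_enum.
by exists Y => //; rewrite setTI.
Qed.

Lemma measurable_fun_rVP d (T : measurableType d) (R : realType) n
    (f : T -> 'rV[R]_n) :
  (forall i, measurable_fun setT (fun t => f t ord0 i)) ->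
  measurable_fun setT f.
Proof.
move=> mf _ B mB; rewrite setTI.
suff H : @measurable _ 'rV[R]_n `<=`
    [set A | measurable (f @^-1` A)] by exact: H.
apply: smallest_sub => [|A /=].
  split => /= [|A mA|F mF].
  - by rewrite preimage_set0; exact: measurable0.
  - by rewrite setTD preimage_setC; exact: measurableC.
  - by rewrite preimage_bigcup; exact: bigcupT_measurable.
rewrite -bigcup_seq => -[i _ [Y mY <-]].
by rewrite setTI -[X in measurable X]setTI; exact: mf.
Qed.

Section snoc.
Variables (R : realType) (n : nat).

(* (y', t) in R^n x R seen as a point of R^(n+1); ord_max is the last axis *)
Definition snoc (yt : 'rV[R]_n * R) : 'rV[R]_n.+1 :=
  \row_i oapp (fun j => yt.1 ord0 j) yt.2 (unlift ord_max i).

Definition unsnoc (x : 'rV[R]_n.+1) : 'rV[R]_n * R :=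
  (\row_j x ord0 (lift ord_max j), x ord0 ord_max).

Lemma snocK : cancel snoc unsnoc.
Proof.
move=> [y t]; rewrite /unsnoc/snoc/= mxE unlift_none/=; congr pair.
by apply/rowP => j; rewrite !mxE liftK.
Qed.

Lemma unsnocK : cancel unsnoc snoc.
Proof.
move=> x; apply/rowP => i; rewrite mxE; case: unliftP => [j|] -> //=.
by rewrite mxE.
Qed.

Lemma measurable_snoc :
  measurable_fun setT (snoc : 'rV[R]_n * measurableTypeR R -> 'rV[R]_n.+1).
Proof.
apply: measurable_fun_rVP => i; rewrite /snoc.
under eq_fun do rewrite mxE.
case: unliftP => [j|] _ /=.
- exact: (measurableT_comp (measurable_coord j)).
- exact: measurable_snd.
Qed.

Lemma measurable_unsnoc : measurable_fun setT
  (unsnoc : 'rV[R]_n.+1 -> 'rV[R]_n * measurableTypeR R).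
Proof.
apply/measurable_fun_pairP; split.
- apply: measurable_fun_rVP => i; rewrite /comp/unsnoc/=.
  under eq_fun do rewrite mxE.
  exact: measurable_coord.
- exact: (@measurable_coord R n.+1 ord_max).
Qed.

End snoc.

Section snoc_measure.
Local Open Scope ereal_scope.
Variables (R : realType) (n : nat).
Variable mu : {sigma_finite_measure set 'rV[R]_n -> \bar R}.

Definition snoc_measure : set 'rV[R]_n.+1 -> \bar R :=
  pushforward (mu \x @lebesgue_measure R) (@snoc R n).

Let pm : {measure set ('rV[R]_n * measurableTypeR R) -> \bar R} :=
  mu \x @lebesgue_measure R.

Let m0 : snoc_measure set0 = 0.
Proof. by rewrite /snoc_measure/pushforward preimage_set0 measure0. Qed.

Let m_ge0 A : 0 <= snoc_measure A.
Proof. exact: (@measure_ge0 _ _ _ pm). Qed.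

Let m_sadd : semi_sigma_additive snoc_measure.
Proof.
move=> F mF tF mUF; rewrite /snoc_measure/pushforward preimage_bigcup.
apply: (@measure_semi_sigma_additive _ _ _ pm).
- by move=> k; rewrite -[X in measurable X]setTI; exact: measurable_snoc.
- apply/trivIsetP => i j _ _ ij; rewrite -preimage_setI.
  by move/trivIsetP : tF => /(_ _ _ I I ij) ->; rewrite preimage_set0.
- rewrite -preimage_bigcup -[X in measurable X]setTI.
  exact: measurable_snoc.
Qed.

HB.instance Definition _ := isMeasure.Build _ _ _ snoc_measure m0 m_ge0 m_sadd.

Let m_sfin : sigma_finite setT snoc_measure.
Proof.
have /sigma_finiteP[F [TF ndF Foo]] := sigma_finiteT mu.
have /sigma_finiteP[G [TG ndG Goo]] := sigma_finiteT (@lebesgue_measure R).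
exists (fun k => @unsnoc R n @^-1` (F k `*` G k)).
  rewrite -preimage_bigcup (_ : \bigcup_i _ = setT) ?preimage_setT//.
  rewrite -subTset => -[y t] _.
  have [i _ Fi] : (\bigcup_i F i) y by rewrite -TF.
  have [j _ Gj] : (\bigcup_i G i) t by rewrite -TG.
  exists (maxn i j) => //; split => /=.
  - by move: y Fi; exact/subsetPset/ndF/leq_maxl.
  - by move: t Gj; exact/subsetPset/ndG/leq_maxr.
move=> k; have [mF Fk] := Foo k; have [mG Gk] := Goo k; split.
  rewrite -[X in measurable X]setTI.
  by apply: measurable_unsnoc => //; exact: measurableX.
rewrite /snoc_measure/pushforward -comp_preimage.
rewrite (_ : _ \o _ = id); last by apply/funext => x /=; rewrite snocK.
by rewrite preimage_id product_measure1E// lte_mul_pinfty// ge0_fin_numE.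
Qed.

HB.instance Definition _ :=
  Measure_isSigmaFinite.Build _ _ _ snoc_measure m_sfin.

End snoc_measure.

(* Iterated product of one-dimensional Lebesgue measures. *)
Fixpoint lebesgue_rV (R : realType) (n : nat) :
    {sigma_finite_measure set 'rV[R]_n -> \bar R} :=
  match n with
  | 0 => dirac (0 : 'rV[R]_0)
  | n'.+1 => snoc_measure (lebesgue_rV R n')
  end.

Definition dot (R : realType) n (x y : 'rV[R]_n) : R :=
  \sum_i x ord0 i * y ord0 i.

(* Euclidean norm; the library norm `|x| on 'rV[R]_n is the sup norm. *)
Definition enorm (R : realType) n (x : 'rV[R]_n) : R := Num.sqrt (dot x x).

Lemma dot_ge0 (R : realType) n (x : 'rV[R]_n) : 0 <= dot x x.
Proof. by apply: sumr_ge0 => i _; rewrite -expr2 sqr_ge0. Qed.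

Lemma measurable_enorm (R : realType) n :
  measurable_fun setT (@enorm R n : 'rV[R]_n -> R).
Proof.
rewrite /enorm; under eq_fun do rewrite -powR12_sqrt ?dot_ge0//.
apply: (@measurableT_comp _ _ _ _ _ _ (@powR R ^~ 2^-1%R)) => //.
apply: measurable_sum => i.
by apply: measurable_funM; exact: measurable_coord.
Qed.

Definition esphere (R : realType) n : set 'rV[R]_n := [set w | enorm w = 1].

Definition hemisphere (R : realType) m : set 'rV[R]_m.+1 :=
  [set w | esphere w /\ 0 < w ord0 ord_max].

Section sphere_measure.
Local Open Scope ereal_scope.
Variables (R : realType) (n : nat).

Definition pointed_ball : set 'rV[R]_n := [set y | (0 < enorm y <= 1)%R].

Definition direction (y : 'rV[R]_n) : 'rV[R]_n := ((enorm y)^-1 *: y)%R.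

Lemma measurable_pointed_ball : measurable pointed_ball.
Proof.
rewrite (_ : pointed_ball = setT `&` @enorm R n @^-1` `]0%R, 1%R]).
  exact: measurable_enorm.
by rewrite setTI; apply/seteqP; split => y; rewrite /pointed_ball/= in_itv.
Qed.

Lemma measurable_direction : measurable_fun setT direction.
Proof.
apply: measurable_fun_rVP => i; rewrite /direction.
under eq_fun do rewrite mxE -powR_inv1 ?sqrtr_ge0//.
apply: measurable_funM; last exact: measurable_coord.
apply: (@measurableT_comp _ _ _ _ _ _ (@powR R ^~ (-1)%R)) => //.
exact: measurable_enorm.
Qed.

(* Surface measure of the unit sphere, as the spherical part of Lebesgue measure
   in polar coordinates: the part of the unit ball lying over A has volume
   sigma(A) / n. It is a measure on R^n carried by the sphere. *)
Definition sphere_measure (A : set 'rV[R]_n) : \bar R :=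
  n%:R%:E * lebesgue_rV R n (direction @^-1` A `&` pointed_ball).

Let cone : {measure set 'rV[R]_n -> \bar R} :=
  measure_function_pushforward__canonical__measure_function_Measure
    (mrestr (lebesgue_rV R n) measurable_pointed_ball) measurable_direction.

Let sphere_measure0 : sphere_measure set0 = 0.
Proof. by rewrite /sphere_measure preimage_set0 set0I measure0 mule0. Qed.

Let sphere_measure_ge0 A : 0 <= sphere_measure A.
Proof. by rewrite mule_ge0// lee_fin. Qed.

Let sphere_measure_sigma_additive : semi_sigma_additive sphere_measure.
Proof.
pose M : {measure set 'rV[R]_n -> \bar R} := mscale (NngNum (ler0n R n)) cone.
exact: (@measure_semi_sigma_additive _ _ _ M).
Qed.

HB.instance Definition _ := isMeasure.Build _ _ _ sphere_measure
  sphere_measure0 sphere_measure_ge0 sphere_measure_sigma_additive.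

End sphere_measure.

(* 1/p and (p-1)/p, read as 0 and 1 for p = +oo; junk at -oo *)
Definition inv_exponent (R : realType) (p : \bar R) : R :=
  if p is r%:E then r^-1 else 0.

Definition conj_ratio (R : realType) (p : \bar R) : R :=
  if p is r%:E then (r - 1) / r else 1.

(* The ambient space is R^n with n = m + 1, and densities live on R^(n-1) = R^m;
   y = (y', 0) is snoc (y', 0), and x_n is x ord0 ord_max. *)
Section potential.
Variables (R : realType) (m : nat) (alpha beta k : R).
Local Notation mu := (lebesgue_rV R m).

Definition integrand (f : 'rV[R]_m -> R) (x : 'rV[R]_m.+1) (y' : 'rV[R]_m) : R :=
  ((x ord0 ord_max `^ alpha) / enorm (snoc (y', 0) - x)) `^ beta * f y'.

Definition potential (f : 'rV[R]_m -> R) (x : 'rV[R]_m.+1) : R :=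
  k * \int[mu]_y' integrand f x y'.

Definition e_n : 'rV[R]_m.+1 := delta_mx ord0 ord_max.

Definition angular (w z : 'rV[R]_m.+1) : R :=
  `|dot (alpha *: e_n - dot w e_n *: w) z|.

Local Open Scope ereal_scope.

(* Extended-real valued, so that no finiteness is presupposed; the last branch is
   p = +oo (p >= 1 throughout). *)
Definition coef (p : \bar R) (z : 'rV[R]_m.+1) : \bar R :=
  (`|k| * beta)%:E *
  match p with
  | r%:E =>
      if r == 1%R then
        ereal_sup [set (angular w z * dot w e_n `^ beta)%:E
                  | w in @hemisphere R m]
      else
        (\int[@sphere_measure R m.+1]_(w in @hemisphere R m)
           (angular w z `^ (r / (r - 1)) *
            dot w e_n `^ (((beta - m.+1%:R) * r + m.+1%:R) / (r - 1)))%:E)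
          `^ ((r - 1) / r)
  | _ =>
      \int[@sphere_measure R m.+1]_(w in @hemisphere R m)
        (angular w z * dot w e_n `^ (beta - m.+1%:R))%:E
  end.

Definition height_exponent (p : \bar R) : R :=
  (2 - m.+1%:R + beta * (1 - alpha) + m%:R * inv_exponent p)%R.

End potential.

Definition gradient (R : realType) n (u : 'rV[R]_n -> R) (x : 'rV[R]_n) :
    'rV[R]_n :=
  \row_i 'D_(delta_mx ord0 i) u x.

(* The real constants c such that F f <= c * ||f||_p for all f in L^p(R^m). *)
Definition bounds (R : realType) m (p : \bar R) (F : ('rV[R]_m -> R) -> R) :
    set R :=
  [set c | forall f, f \in Lfun (lebesgue_rV R m) p ->
     ((F f)%:E <= c%:E * 'N[lebesgue_rV R m]_p[EFin \o f])%E].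

(* C is finite and is the smallest such constant. *)
Definition is_sharp_coefficient (R : realType) m (p : \bar R)
    (F : ('rV[R]_m -> R) -> R) (C : \bar R) : Prop :=
  exists2 c : R, C = c%:E & bounds p F c /\ lbound (bounds p F) c.

(* Main.v *)
Require Import Defs.
From mathcomp Require Import all_boot all_order all_algebra.
From mathcomp Require Import all_classical all_reals all_analysis.
From mathcomp Require Import measurable_realfun ess_sup_inf.
From mathcomp Require Import ring lra.
Import Order.TTheory GRing.Theory Num.Theory.
Import numFieldNormedType.Exports.

(** Write $w = w(y)$ for the unit vector pointing from the boundary point
    $(y, 0)$ to $x$, so that $w_n = x_n / |y - x| > 0$. Differentiating the
    integrand in direction $z$ gives
    $$\partial_z \left(\frac{x_n^\alpha}{|y - x|}\right)^\beta
      = \beta\, x_n^{\beta (\alpha - 1) - 1}\, K_z(y), \qquad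
      K_z(y) = w_n^\beta\, (\alpha e_n - w_n w, z),$$
    where $K_z$ depends on $y$ through $w$ only ([kernel],
    [is_derive_integrand]). The derivative may be taken under the integral
    sign: when $x$ moves by at most $x_n / 2$ the elevation $w_n$ grows by at
    most a factor 3, so that the derivatives are dominated by a multiple of
    $w_n^\beta |f|$ ([elevation_translate], [derivable_potential]). That
    function is integrable because $w_n^\beta$ lies in the conjugate space
    $L^q$: this is the convergence of $\int (1 + |y|^2)^{-s/2} dy$ over $R^m$
    for $s > m$ ([integral_bracket_lty]), applied with $s = \beta q$, and it
    is where the lower bound on $\beta$ enters; for $p = 1$ it is the bound
    $w_n^\beta \le 1$.

    Hence $(\nabla u (x), z)$ is a constant times $\int K_z f$, and its sharp
    coefficient is that constant times the conjugate norm of $K_z$. The upper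
    bound is the Hoelder inequality. For the lower bound one tests with
    $f = h\, \mathrm{sign} (K_z)$, where $h = |K_z|^{q-1}$ for
    $1 < p < \infty$, $h = 1$ for $p = \infty$, and $h$ is the indicator of a
    small cube for $p = 1$; in the last case the continuity of $K_z$ identifies
    the essential supremum with the supremum ([pairing_sharp]).

    It remains to express the conjugate norm on the sphere. The map
    $y \mapsto w(y)$ is a bijection of $R^m$ onto the open hemisphere, under
    which $dy$ becomes $x_n^m w_n^{-n} d\sigma$, where $n = m + 1$. As $\sigma$
    is defined by the volume of cones, this Jacobian comes out of the scaling
    $y = t v$ of the horizontal slices of the half-ball and the integral
    $\int_0^a n t^m dt = a^n$ ([ge0_integral_hemisphere],
    [ge0_integral_sight_sphere], [dual_norm_kernel]).

    Finally $|\nabla u|$ is the supremum of $|(\nabla u, z)|$ over unit vectors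
    $z$, and the sharp coefficient of such a supremum is the supremum of the
    sharp coefficients; it is finite because the coordinate directions control
    all the others ([is_sharp_coefficient_enorm]). *)

Set Implicit Arguments.
Unset Strict Implicit.
Unset Printing Implicit Defensive.

Local Open Scope classical_set_scope.
Local Open Scope ring_scope.

(** * Euclidean vectors *)

Section euclidean.
Context {R : realType}.
Implicit Types n : nat.

Lemma dotC n (x y : 'rV[R]_n) : dot x y = dot y x.
Proof. by apply: eq_bigr => i _; rewrite mulrC. Qed.

Lemma dotDl n (x y z : 'rV[R]_n) : dot (x + y) z = dot x z + dot y z.
Proof. by rewrite -big_split; apply: eq_bigr => i _; rewrite mxE mulrDl. Qed.

Lemma dotZl n (a : R) (x z : 'rV[R]_n) : dot (a *: x) z = a * dot x z.
Proof. by rewrite /dot mulr_sumr; apply: eq_bigr => i _; rewrite mxE mulrA. Qed.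

Lemma dotZr n (a : R) (x z : 'rV[R]_n) : dot z (a *: x) = a * dot z x.
Proof. by rewrite dotC dotZl dotC. Qed.

Lemma dotDr n (x y z : 'rV[R]_n) : dot z (x + y) = dot z x + dot z y.
Proof. by rewrite dotC dotDl !(dotC z). Qed.

Lemma dotNl n (x z : 'rV[R]_n) : dot (- x) z = - dot x z.
Proof. by rewrite -scaleN1r dotZl mulN1r. Qed.

Lemma dotBl n (x y z : 'rV[R]_n) : dot (x - y) z = dot x z - dot y z.
Proof. by rewrite dotDl dotNl. Qed.

Lemma dotBr n (a b c : 'rV[R]_n) : dot c (a - b) = dot c a - dot c b.
Proof. by rewrite !(dotC c) dotBl. Qed.

Lemma dot_delta n (x : 'rV[R]_n) i : dot x (delta_mx ord0 i) = x ord0 i.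
Proof.
rewrite /dot (bigD1 i)//= mxE !eqxx mulr1 big1 ?addr0// => j ji.
by rewrite mxE eqxx (negbTE ji) mulr0.
Qed.

Lemma dot_line n (u v : 'rV[R]_n) (h : R) :
  dot (h *: v + u) (h *: v + u) = dot u u + (2 * dot u v + dot v v * h) * h.
Proof. by rewrite dotDl !dotDr !dotZl !dotZr (dotC v u); ring. Qed.

Lemma dot_snoc n (y y' : 'rV[R]_n) (t t' : R) :
  dot (snoc (y, t)) (snoc (y', t')) = dot y y' + t * t'.
Proof.
rewrite /dot (bigD1_ord ord_max)//= !mxE unlift_none/= addrC; congr (_ + _).
by apply: eq_bigr => j _; rewrite !mxE liftK.
Qed.

Lemma snocZ n (a : R) (y : 'rV[R]_n) (t : R) :
  snoc (a *: y, a * t) = a *: snoc (y, t).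
Proof.
by apply/rowP => i; rewrite !mxE; case: unliftP => [j|] _ //=; rewrite mxE.
Qed.

Lemma snoc_last n (y : 'rV[R]_n) (t : R) : snoc (y, t) ord0 ord_max = t.
Proof. by rewrite mxE unlift_none. Qed.

Lemma snocDZ n (a : 'rV[R]_n.+1) (c : R) (y : 'rV[R]_n) (t : R) :
  a + c *: snoc (y, t) = snoc ((unsnoc a).1 + c *: y, (unsnoc a).2 + c * t).
Proof.
rewrite -[a in LHS]unsnocK; apply/rowP => i; rewrite !mxE.
by case: unliftP => [j|] _ //=; rewrite !mxE.
Qed.

Lemma enorm_ge0 n (x : 'rV[R]_n) : 0 <= enorm x. Proof. exact: sqrtr_ge0. Qed.

Lemma sqr_enorm n (x : 'rV[R]_n) : enorm x ^+ 2 = dot x x.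
Proof. by rewrite sqr_sqrtr// dot_ge0. Qed.

Lemma enormZ n (a : R) (x : 'rV[R]_n) : enorm (a *: x) = `|a| * enorm x.
Proof.
rewrite /enorm dotZl dotZr mulrA -expr2 sqrtrM ?sqr_ge0//.
by rewrite sqrtr_sqr.
Qed.

Lemma enormN n (u : 'rV[R]_n) : enorm (- u) = enorm u.
Proof. by rewrite -scaleN1r enormZ normrN1 mul1r. Qed.

Lemma ler_coord_enorm n (x : 'rV[R]_n) i : `|x ord0 i| <= enorm x.
Proof.
rewrite -sqrtr_sqr ler_wsqrtr// /dot (bigD1 i)//= expr2 lerDl.
by apply: sumr_ge0 => j _; rewrite -expr2 sqr_ge0.
Qed.

Lemma enorm_gt0 n (x : 'rV[R]_n) i : x ord0 i != 0 -> 0 < enorm x.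
Proof.
by move=> xi; rewrite (lt_le_trans _ (ler_coord_enorm x i))// normr_gt0.
Qed.

Lemma enorm_snoc1_gt0 n (v : 'rV[R]_n) : 0 < enorm (snoc (v, 1)).
Proof. by apply: (enorm_gt0 (i := ord_max)); rewrite snoc_last oner_neq0. Qed.

Lemma enorm_delta n (i : 'I_n) : enorm (delta_mx ord0 i : 'rV[R]_n) = 1.
Proof. by rewrite /enorm dot_delta mxE !eqxx sqrtr1. Qed.

(** Cauchy-Schwarz against a unit vector: expand $|v - (u, v) u|^2 \ge 0$. *)
Lemma ler_dot_enorm n (u v : 'rV[R]_n) : enorm u = 1 -> `|dot u v| <= enorm v.
Proof.
move=> u1; have uu : dot u u = 1 by rewrite -sqr_enorm u1 expr1n.
rewrite -sqrtr_sqr ler_wsqrtr// -subr_ge0.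
have := dot_ge0 (v - dot u v *: u).
rewrite dotBl !dotBr !dotZl !dotZr uu (dotC v u) expr2 mulr1 subrr subr0.
by [].
Qed.

(** The triangle inequality for a displacement along a unit vector, which
    follows from Cauchy-Schwarz after squaring. *)
Lemma enorm_translate n (v s : 'rV[R]_n) (t : R) : enorm v = 1 ->
  enorm s <= enorm (t *: v + s) + `|t|.
Proof.
move=> v1; have h : s = (- t) *: v + (t *: v + s).
  by rewrite addrA -scalerDl addNr scale0r add0r.
move: (t *: v + s) h => u ->.
have vv : dot v v = 1 by rewrite -sqr_enorm v1 expr1n.
rewrite -[leRHS]ger0_norm ?addr_ge0 ?enorm_ge0// -sqrtr_sqr ler_wsqrtr//.
rewrite dot_line vv sqrrD sqr_enorm real_normK ?num_real//.
have := ler_dot_enorm u v1; rewrite dotC => uv.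
have : - (t * dot u v) <= `|t| * enorm u.
  by rewrite (le_trans (ler_norm _))// normrN normrM ler_wpM2l.
lra.
Qed.

Lemma directionZ n (a : R) (x : 'rV[R]_n) : 0 < a ->
  direction (a *: x) = direction x.
Proof.
move=> a0; rewrite /direction enormZ gtr0_norm// scalerA; congr (_ *: _).
by rewrite invfM mulrC mulrA mulfV ?gt_eqF// mul1r.
Qed.

Lemma enorm_direction n (x : 'rV[R]_n) : 0 < enorm x -> enorm (direction x) = 1.
Proof.
by move=> x0; rewrite enormZ gtr0_norm ?invr_gt0// mulVf// gt_eqF.
Qed.

End euclidean.

(** * Lebesgue measure on R^n *)

Section lebesgue_rV_theory.
Context {R : realType}.
Local Open Scope ereal_scope.

Lemma measurable_snocl n (t : R) :
  measurable_fun setT (fun y : 'rV[R]_n => snoc (y, t)).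
Proof.
exact: (measurableT_comp (@measurable_snoc R n) (@measurable_pair2 _ _ _ _ t)).
Qed.

(** Tonelli's theorem for the product structure of $R^{n+1}$, with the last
    coordinate outermost. *)
Lemma ge0_integral_rVS n (f : 'rV[R]_n.+1 -> \bar R) :
  measurable_fun setT f -> (forall y, 0 <= f y) ->
  \int[lebesgue_rV R n.+1]_y f y =
  \int[@lebesgue_measure R]_t \int[lebesgue_rV R n]_y f (snoc (y, t)).
Proof.
move=> mf f0.
rewrite -[LHS]/(\int[pushforward (lebesgue_rV R n \x @lebesgue_measure R)
                     (@snoc R n)]_y f y).
rewrite ge0_integral_pushforward//; last exact: measurable_snoc.
rewrite preimage_setT; apply: (fubini_tonelli2 (m1 := lebesgue_rV R n)
  (f \o @snoc R n : 'rV[R]_n * measurableTypeR R -> \bar R)) => //=.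
exact: (measurableT_comp mf (@measurable_snoc R n)).
Qed.

Lemma measurable_integral_snoc n (f : 'rV[R]_n.+1 -> \bar R) :
  measurable_fun setT f -> (forall y, 0 <= f y) ->
  measurable_fun [set: measurableTypeR R]
    (fun t => \int[lebesgue_rV R n]_y f (snoc (y, t))).
Proof.
move=> mf f0; apply: (measurable_fun_fubini_tonelli_G (m1 := lebesgue_rV R n)
  (f \o @snoc R n : 'rV[R]_n * measurableTypeR R -> \bar R)) => //=.
exact: (measurableT_comp mf (@measurable_snoc R n)).
Qed.

Lemma measurable_shift_scale n (a : 'rV[R]_n) (c : R) :
  measurable_fun setT (fun y : 'rV[R]_n => a + c *: y)%R.
Proof.
apply: measurable_fun_rVP => i; under eq_fun do rewrite !mxE.
apply: measurable_funD => //; apply: measurable_funM => //.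
exact: measurable_coord.
Qed.

(** Both sides are measures agreeing on half-open intervals. Negative slopes
    reduce to positive ones by the reflection invariance of Lebesgue measure. *)
Lemma lebesgue_measure_affine (a c : R) (A : set R) :
  c != 0%R -> measurable A ->
  `|c|%:E * lebesgue_measure ((fun t => a + c * t)%R @^-1` A) =
  @lebesgue_measure R A.
Proof.
wlog c0 : c / (0 < c)%R => [wlg cn0 mA|_ mA].
  have [c0|c0] := ltP 0%R c; first exact: wlg.
  have Nc0 : (0 < - c)%R by rewrite oppr_gt0 lt_neqAle cn0.
  rewrite -[RHS](wlg _ Nc0) ?gt_eqF// normrN; congr (_ * _).
  rewrite -[RHS]lebesgue_measureN; last first.
    rewrite -[X in measurable X]setTI.
    have : measurable_fun [set: R] (fun t : R => a + - c * t)%R.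
      by apply: measurable_funD => //; exact: measurable_funM.
    exact.
  by congr (lebesgue_measure _); apply/seteqP; split => t /=; rewrite mulrNN.
have mphi : measurable_fun setT
    ((fun t => a + c * t)%R : measurableTypeR R -> measurableTypeR R).
  by apply: measurable_funD => //; exact: measurable_funM.
pose nu : {measure set (measurableTypeR R) -> \bar R} :=
  mscale (NngNum (ltW c0))
  (measure_function_pushforward__canonical__measure_function_Measure
    (@lebesgue_measure R) mphi).
transitivity (nu A); first by rewrite /nu/= /mscale/= gtr0_norm.
apply/esym/lebesgue_measure_unique => //= _ [[u v]] _ <-.
rewrite /mscale/= /pushforward.
have -> : (fun t => a + c * t)%R @^-1` `]u, v] =
    `]((u - a) / c)%R, ((v - a) / c)%R]%classic.
  apply/seteqP; split => t /=; rewrite !in_itv/= ltr_pdivrMr// ler_pdivlMr//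
    ltrBlDl lerBrDl mulrC//.
rewrite !lebesgue_measure_itv/= !lte_fin ltr_pM2r ?invr_gt0// ltrD2r.
case: ifP => _; last by rewrite mule0.
by rewrite -!EFinB -EFinM; congr (_%:E); field; rewrite gt_eqF.
Qed.

Lemma ge0_integral_affine1 (a c : R) (f : measurableTypeR R -> \bar R) :
  c != 0%R -> measurable_fun setT f -> (forall t, 0 <= f t) ->
  \int[@lebesgue_measure R]_t f t =
  `|c|%:E * \int[@lebesgue_measure R]_t f (a + c * t)%R.
Proof.
move=> c0 mf f0.
have mphi : measurable_fun setT
    ((fun t => a + c * t)%R : measurableTypeR R -> measurableTypeR R).
  by apply: measurable_funD => //; exact: measurable_funM.
rewrite -[X in _ * X](@ge0_integral_pushforward _ _ _ _ _ _ mphi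
  lebesgue_measure setT f)//.
pose nu : {measure set (measurableTypeR R) -> \bar R} :=
  mscale (NngNum (normr_ge0 c))
  (measure_function_pushforward__canonical__measure_function_Measure
    (@lebesgue_measure R) mphi).
rewrite -[RHS](ge0_integral_mscale _ _ (NngNum (normr_ge0 c)))//.
apply: eq_measure_integral => A mA _.
exact/esym/(lebesgue_measure_affine a c0).
Qed.

(** Induction on the dimension: slicing along the last axis leaves the same
    homothety in each factor. *)
Lemma ge0_integral_affine n (a : 'rV[R]_n) (c : R) (f : 'rV[R]_n -> \bar R) :
  c != 0%R -> measurable_fun setT f -> (forall y, 0 <= f y) ->
  \int[lebesgue_rV R n]_y f y =
  (`|c| ^+ n)%:E * \int[lebesgue_rV R n]_y f (a + c *: y)%R.
Proof.
move=> c0; elim: n a f => [a f mf f0|n IH a f mf f0].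
  by rewrite expr0 mul1e; apply: eq_integral => y _; congr f; apply/rowP => -[].
rewrite !ge0_integral_rVS//; last first.
  exact: (measurableT_comp mf (measurable_shift_scale _ _)).
have I0 t : 0 <= \int[lebesgue_rV R n]_y f (snoc (y, t)) by exact: integral_ge0.
rewrite (ge0_integral_affine1 (unsnoc a).2 c0
  (measurable_integral_snoc mf f0) I0).
rewrite exprS EFinM -muleA; congr (_ * _).
rewrite -ge0_integralZl//; last 2 first.
- apply: (measurable_integral_snoc (f := fun y => f (a + c *: y)%R)) => //.
  exact: (measurableT_comp mf (measurable_shift_scale _ _)).
- by move=> t _; exact: integral_ge0.
apply: eq_integral => t _; rewrite (IH (unsnoc a).1)//; last first.
  exact: (measurableT_comp mf (measurable_snocl _)).
congr (_ * _).
by apply: eq_integral => y _; rewrite snocDZ.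
Qed.

(** Used instead of Euclidean balls because their volume is explicit. *)
Definition box n (a : 'rV[R]_n) (d : R) : set 'rV[R]_n :=
  [set y | forall i, `|y ord0 i - a ord0 i| <= d]%R.

Lemma measurable_box n (a : 'rV[R]_n) d : measurable (box a d).
Proof.
rewrite (_ : box a d = \bigcap_(i in setT)
    (fun y : 'rV[R]_n => `|y ord0 i - a ord0 i|%R) @^-1` `]-oo, d]).
  apply: fin_bigcap_measurable => // i _.
  rewrite -[X in measurable X]setTI.
  have mf : measurable_fun setT (fun y : 'rV[R]_n => `|y ord0 i - a ord0 i|%R).
    apply: measurableT_comp => //; apply: measurable_funB => //.
    exact: measurable_coord.
  by apply: mf.
by apply/seteqP; split => y; rewrite /box /bigcap/= => H i;
  [move=> _; rewrite in_itv/=|have := H i I; rewrite in_itv].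
Qed.

Lemma lebesgue_rV_box n (a : 'rV[R]_n) d : (0 < d)%R ->
  lebesgue_rV R n (box a d) = ((2 * d) ^+ n)%:E.
Proof.
move=> d0; elim: n a => [a|n IH a].
  rewrite /= expr0 (_ : box a d = setT) ?diracT//.
  by apply/seteqP; split => // y _ [].
rewrite /= /snoc_measure /pushforward.
have -> : @snoc R n @^-1` box a d = box (unsnoc a).1 d `*`
    [set` `[((unsnoc a).2 - d)%R, ((unsnoc a).2 + d)%R]].
  apply/seteqP; split => -[y t]; rewrite /box/=.
    move=> H; split => [i|].
      by have := H (lift ord_max i); rewrite !mxE liftK.
    by have := H ord_max; rewrite mxE unlift_none/= in_itv/= ler_distl.
  move=> [H1 H2] i; rewrite mxE; case: unliftP => [j|] ->/=.
    by have := H1 j; rewrite mxE.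
  by move: H2; rewrite in_itv/= ler_distl.
rewrite product_measure1E//; last exact: measurable_box.
rewrite [X in X * _](IH (unsnoc a).1).
rewrite [X in _ * X](_ : _ = lebesgue_measure
  ([set` `[((unsnoc a).2 - d)%R, ((unsnoc a).2 + d)%R]] : set R))//.
rewrite lebesgue_measure_itv/= lte_fin ifT; last lra.
by rewrite -EFinB -EFinM exprSr; congr (_ * _)%:E; ring.
Qed.

Lemma lebesgue_rV_setT_gt0 n : 0 < lebesgue_rV R n setT.
Proof.
rewrite (@lt_le_trans _ _ (lebesgue_rV R n (box 0%R 1%R)))//.
  by rewrite lebesgue_rV_box// lte_fin exprn_gt0// mulr1.
by rewrite le_measure// inE//; exact: measurable_box.
Qed.

End lebesgue_rV_theory.

(** * Convergence of the integral of (1 + |y|^2)^(-s/2) *)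

Section bracket.
Context {R : realType}.
Local Open Scope ereal_scope.

Lemma cvg_powRN_pinfty (b : R) : (0 < b)%R ->
  (fun t : R => (1 + t) `^ (- b))%R @ +oo%R --> (0%R : R).
Proof.
move=> b0; apply/cvgrPdist_le => e e0.
have c0 : (0 < e `^ (- b^-1))%R by exact: powR_gt0.
have ce : e = ((e `^ (- b^-1)) `^ (- b))%R.
  by rewrite -powRrM mulrNN mulVf ?gt_eqF// powRr1// ltW.
move: c0 ce; move: (e `^ (- b^-1))%R => c c0 ->.
have : (\forall t \near (+oo%R : set_system R), c <= t)%R.
  by apply: nbhs_pinfty_ge; rewrite num_real.
apply: filterS => t ct.
have {}ct : (c <= 1 + t)%R by rewrite (le_trans ct)// lerDr.
have t0 : (0 < 1 + t)%R by exact: lt_le_trans ct.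
rewrite sub0r normrN ger0_norm ?powR_ge0// !powRN lef_pV2 ?posrE ?powR_gt0//.
by apply: ge0_ler_powR => //; rewrite ?nnegrE ltW.
Qed.

(** The primitive $(1 + t)^{1-a} / (1 - a)$ vanishes at infinity. *)
Lemma integral_powR_shift_lty (a : R) : (1 < a)%R ->
  \int[@lebesgue_measure R]_(t in `[0%R, +oo[) ((1 + t) `^ (- a))%:E < +oo.
Proof.
move=> a1.
have dG (b x : R) : (0 <= x)%R ->
    is_derive x 1%R (fun t : R => (1 + t) `^ b)%R (b * (1 + x) `^ (b - 1))%R.
  move=> x0; have x1 : (0 < 1 + x)%R by rewrite ltr_pwDl.
  have d1 : is_derive x 1%R (fun t : R => 1 + t)%R 1%R.
    have := is_deriveD (is_derive_cst (1%R : R) x 1%R)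
      (is_derive_id x (1%R : R)).
    by rewrite add0r.
  have := @is_derive1_comp R (@powR R ^~ b) (fun t => 1 + t)%R x _ _
    (is_derive1_powR b x1) d1.
  by rewrite mulr1.
have dF (x : R) : (0 <= x)%R ->
    is_derive x 1%R (fun t => (1 + t) `^ (1 - a) / (1 - a))%R
      ((1 + x) `^ (- a))%R.
  move=> x0.
  have := is_deriveM (dG (1 - a)%R x x0) (is_derive_cst (1 - a)^-1%R x 1%R).
  move=> /is_derive_eq; apply.
  rewrite scaler0 add0r /GRing.scale/= mulrA mulVf ?subr_eq0 ?lt_eqF// mul1r.
  by congr (_ `^ _)%R; ring.
rewrite (@ge0_continuous_FTC2y _ _
  (fun t => (1 + t) `^ (1 - a) / (1 - a))%R _ 0%R)//.
- by rewrite -EFinB ltry.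
- by move=> t _; exact: powR_ge0.
- apply: continuous_in_subspaceT => t; rewrite inE/= in_itv/= andbT => t0.
  by apply/differentiable_continuous/derivable1_diffP; case: (dG (- a)%R t).
- rewrite -(mul0r (1 - a)^-1)%R; apply: cvgMl; rewrite -opprB.
  by apply: cvg_powRN_pinfty; rewrite subr_gt0.
- by move=> x /ltW/dF[].
- apply: cvg_at_right_filter.
  have [/derivable1_diffP/differentiable_continuous + _] := dF 0%R (lexx _).
  exact.
- move=> x; rewrite in_itv/= andbT => /ltW/dF dx.
  by rewrite derive1E (@derive_val _ _ _ _ _ _ _ dx).
Qed.

Lemma integral_bracket1_lty (a : R) : (1 < a)%R ->
  \int[@lebesgue_measure R]_t ((1 + t * t) `^ (- (a / 2)))%:E < +oo.
Proof.
move=> a1.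
rewrite ge0_symfun_integralT; last 3 first.
- by move=> t; exact: powR_ge0.
- move=> t; have t1 : (0 < 1 + t * t)%R by rewrite ltr_wpDr// -expr2 sqr_ge0.
  have dt := is_deriveD (is_derive_cst (1%R : R) t 1%R)
    (is_deriveM (is_derive_id t (1%R : R)) (is_derive_id t (1%R : R))).
  have := @is_derive1_comp R (@powR R ^~ (- (a / 2))%R) _ t _ _
    (is_derive1_powR _ t1) dt.
  by case=> /derivable1_diffP/differentiable_continuous + _; exact.
- by move=> t /=; rewrite mulrNN.
have mp (b : R) (h : R -> R) (D : set R) : measurable_fun setT h ->
    measurable_fun D (fun t => (h t `^ b)%:E).
  move=> mh; apply: measurable_funTS; apply/measurable_EFinP.
  exact: (@measurableT_comp _ _ _ _ _ _ (@powR R ^~ b)).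
rewrite -set_itvcy lte_mul_pinfty//.
apply: (@le_lt_trans _ _ (\int[@lebesgue_measure R]_(t in `[0%R, +oo[)
   ((2 `^ (a / 2))%:E * ((1 + t) `^ (- a))%:E))).
  apply: ge0_le_integral => //.
  - by move=> t _; rewrite lee_fin powR_ge0.
  - by apply: mp; apply: measurable_funD => //; exact: measurable_funM.
  - by apply: measurable_funeM; apply: mp; apply: measurable_funD.
  - move=> t; rewrite /= in_itv/= andbT => t0.
    have t1 : (0 < 1 + t * t)%R by rewrite ltr_wpDr// mulr_ge0.
    have t2 : (0 < 1 + t)%R by rewrite ltr_wpDr.
    (* (1 + t)^2 <= 2 (1 + t^2) *)
    rewrite -EFinM lee_fin !powRN ler_pdivlMr ?powR_gt0// mulrC.
    rewrite ler_pdivrMr ?powR_gt0// -powRM//; last exact: ltW.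
    have -> : ((1 + t) `^ a = ((1 + t) ^+ 2) `^ (a / 2))%R.
      by rewrite -powR_mulrn ?ltW// -powRrM; congr (_ `^ _)%R; field.
    have a0 : (0 < a)%R by exact: lt_trans a1.
    apply: ge0_ler_powR; 
      rewrite ?nnegrE ?divr_ge0 ?mulr_ge0 ?(ltW a0) ?(ltW t1)//
        ?exprn_ge0 ?(ltW t2)//.
    by rewrite -subr_ge0 (_ : _ - _ = (1 - t) ^+ 2)%R ?sqr_ge0//; ring.
rewrite ge0_integralZl//.
- rewrite lte_mul_pinfty// ?lee_fin ?powR_ge0//.
  exact: integral_powR_shift_lty.
- by apply: mp; apply: measurable_funD.
- by move=> t _; rewrite lee_fin powR_ge0.
Qed.

(** Induction on $n$: the substitution $y = \sqrt{1 + t^2}\, v$ factors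
    $1 + t^2 + |y|^2$ as $(1 + t^2)(1 + |v|^2)$, and the outer integral becomes
    the one-dimensional one with exponent $s - n > 1$. *)
Lemma integral_bracket_lty n (s : R) : (n%:R < s)%R ->
  \int[lebesgue_rV R n]_y ((1 + dot y y) `^ (- (s / 2)))%:E < +oo.
Proof.
have mb k (r : R) : measurable_fun setT
    (fun y : 'rV[R]_k => ((1 + dot y y) `^ (- (r / 2)))%:E).
  apply/measurable_EFinP.
  apply: (@measurableT_comp _ _ _ _ _ _ (@powR R ^~ (- (r / 2))%R)) => //.
  apply: measurable_funD => //; apply: measurable_sum => i.
  by apply: measurable_funM; exact: measurable_coord.
have b0 k (r : R) (y : 'rV[R]_k) : 0 <= ((1 + dot y y) `^ (- (r / 2)))%:E.
  by rewrite lee_fin powR_ge0.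
have mp (b : R) : measurable_fun [set: measurableTypeR R]
    (fun t : R => ((1 + t * t) `^ b)%:E).
  apply/measurable_EFinP.
  apply: (@measurableT_comp _ _ _ _ _ _ (@powR R ^~ b)) => //.
  by apply: measurable_funD => //; exact: measurable_funM.
elim: n s => [s s0|n IH s ns].
  have := @integral_dirac _ _ (0 : 'rV[R]_0)%R R _ measurableT _ (mb 0%N s).
  by rewrite diracT mul1e => E; rewrite [X in X < _]E ltry.
rewrite ge0_integral_rVS//.
have Q0 (t : R) : (0 < 1 + t * t)%R by rewrite ltr_wpDr// -expr2 sqr_ge0.
rewrite [X in X < _](_ : _ = \int[@lebesgue_measure R]_t
  (((1 + t * t) `^ (- ((s - n%:R) / 2)))%:E *
   \int[lebesgue_rV R n]_y ((1 + dot y y) `^ (- (s / 2)))%:E)); last first.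
  apply: eq_integral => t _.
  have q0 : (0 < Num.sqrt (1 + t * t))%R by rewrite sqrtr_gt0.
  have c0 : Num.sqrt (1 + t * t)%R != 0%R by rewrite gt_eqF.
  have mt := measurableT_comp (mb n.+1 s) (@measurable_snocl R n t).
  have mc := measurableT_comp mt
    (measurable_shift_scale (0 : 'rV[R]_n)%R (Num.sqrt (1 + t * t))).
  rewrite (ge0_integral_affine 0%R c0 mt (fun y => b0 n.+1 s (snoc (y, t)))).
  rewrite -[RHS](ge0_integralZl _ measurableT (mb n s) (fun y _ => b0 n s y))
    ?lee_fin ?powR_ge0//.
  have k0 : 0 <= (`|Num.sqrt (1 + t * t)| ^+ n)%:E by rewrite lee_fin exprn_ge0.
  rewrite -[LHS](ge0_integralZl _ measurableT mc (fun y _ => b0 n.+1 s _) k0).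
  apply: eq_integral => v _; rewrite -!EFinM add0r dot_snoc.
  rewrite dotZl dotZr; congr (_%:E).
  have -> : (1 + (Num.sqrt (1 + t * t) * (Num.sqrt (1 + t * t) * dot v v) +
     t * t) = (1 + t * t) * (1 + dot v v))%R.
    by rewrite mulrA -expr2 sqr_sqrtr ?ltW//; ring.
  rewrite powRM ?ltW//; last by rewrite ltr_wpDr// dot_ge0.
  rewrite mulrA; congr (_ * _)%R.
  rewrite gtr0_norm// -powR_mulrn ?ltW// -powR12_sqrt ?ltW//.
  rewrite -powRrM -powRD; last first.
    by rewrite [_ != _](_ : _ = true) ?implybT// gt_eqF.
  by congr (_ `^ _)%R; field.
have J0 : 0 <= \int[lebesgue_rV R n]_y ((1 + dot y y) `^ (- (s / 2)))%:E.
  by apply: integral_ge0 => y _; exact: b0.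
have p0 (b t : R) : 0 <= ((1 + t * t) `^ b)%:E by rewrite lee_fin powR_ge0.
rewrite [X in X < _](ge0_integralZr _ measurableT (mp _)
  (fun t _ => p0 _ t) J0).
apply: lte_mul_pinfty.
- by apply: integral_ge0 => t _; rewrite lee_fin powR_ge0.
- rewrite ge0_fin_numE.
    by apply: integral_bracket1_lty; rewrite ltrBrDr -natr1 addrC in ns *.
  by apply: integral_ge0 => t _; rewrite lee_fin powR_ge0.
- by apply: IH; rewrite (lt_trans _ ns)// ltr_nat.
Qed.

End bracket.

(** * Integration over the open hemisphere *)

Section polar.
Context {R : realType}.
Local Open Scope ereal_scope.

Lemma measurable_hemisphere m : measurable (@hemisphere R m).
Proof.
rewrite (_ : hemisphere (m:=m) = (@enorm R m.+1 @^-1` [set 1%R]) `&`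
   ((fun w : 'rV[R]_m.+1 => w ord0 ord_max) @^-1` `]0%R, +oo[)); last first.
  apply/seteqP; split => w [w1 w2]; split => //; move: w2.
    by rewrite /= in_itv/= andbT.
  by rewrite /= in_itv/= andbT.
apply: measurableI; rewrite -[X in measurable X]setTI.
  exact: (measurable_enorm (n:=m.+1)).
exact: (measurable_coord (n := m.+1) ord_max).
Qed.

(** The restricted measure charges only the part of the domain inside $D$. *)
Lemma ge0_integral_mrestr d (T : measurableType d)
    (mu : {measure set T -> \bar R}) (D E : set T) (mD : measurable D)
    (f : T -> \bar R) : measurable E -> measurable_fun setT f ->
  (forall x, 0 <= f x) ->
  \int[mrestr mu mD]_(x in E) f x = \int[mu]_(x in E `&` D) f x.
Proof.
move=> mE mf f0.
rewrite -[in LHS](setUIDK E D).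
rewrite ge0_integral_setU//.
- rewrite (null_set_integral (N := E `\` D)) ?adde0.
  + apply: eq_measure_integral => A mA AD.
    rewrite -[LHS]/(mu (A `&` D)) setIidl//.
    by apply: subset_trans AD _; exact: subIsetr.
  + exact: measurableD.
  + exact: measurable_funTS.
  + by rewrite -[LHS]/(mu ((E `\` D) `&` D)) setDE -setIA setICl setI0 measure0.
- exact: measurableI.
- exact: measurableD.
- exact: measurable_funTS.
- by rewrite disj_set2E setDE setIACA setICr setI0.
Qed.

Lemma integral_powers m (a : R) : (0 < a)%R ->
  \int[@lebesgue_measure R]_t
    (if (0 < t <= a) then t ^+ m else 0)%R%:E = (a ^+ m.+1 / m.+1%:R)%:E.
Proof.
move=> a0.
transitivity (\int[@lebesgue_measure R]_(t in `]0%R, a]) (t ^+ m)%:E).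
  rewrite [RHS]integral_mkcond; apply: eq_integral => t _.
  rewrite /patch; case: ifPn => [h|h]; first by rewrite mem_set//= in_itv.
  by rewrite memNset//= in_itv/=; exact/negP.
rewrite integral_itv_obnd_cbnd; last first.
  by apply/measurable_EFinP; apply: measurable_funTS; exact: exprn_measurable.
rewrite (@continuous_FTC2 _ _ (fun t => t ^+ m.+1 / m.+1%:R)%R)//.
- by rewrite expr0n/= mul0r sube0.
- by apply: continuous_subspaceT; exact: exprn_continuous.
- split.
  + by move=> t _; apply: derivableM => //; exact: exprn_derivable.
  + apply: cvg_at_right_filter; apply: cvgMl; exact: exprn_continuous.
  + apply: cvg_at_left_filter; apply: cvgMl; exact: exprn_continuous.
- move=> t _; rewrite derive1Mr//; last exact: exprn_derivable.
  by rewrite exp_derive1/= /GRing.scale/= mulrC mulKf ?pnatr_eq0.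
Qed.

Lemma direction_hemisphereE m :
  (@direction R m.+1 @^-1` @hemisphere R m) `&` @pointed_ball R m.+1 =
  [set y : 'rV[R]_m.+1 | 0 < y ord0 ord_max /\ enorm y <= 1]%R.
Proof.
apply/seteqP; split => y; rewrite /hemisphere /pointed_ball/=.
  move=> [[_ dy0] /andP[y0 y1]]; split => //.
  by move: dy0; rewrite mxE pmulr_rgt0// invr_gt0.
move=> [yn y1]; have y0 : (0 < enorm y)%R.
  by apply: (enorm_gt0 (i := ord_max)); rewrite gt_eqF.
split; [split|exact/andP].
  exact: enorm_direction.
by rewrite mxE pmulr_rgt0// invr_gt0.
Qed.

(** The gnomonic projection $v \mapsto (v, 1) / |(v, 1)|$ of $R^m$ onto the
    open hemisphere has Jacobian $|(v, 1)|^{-(m+1)}$. Slice the half-ball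
    horizontally; scaling the slice at height $t$ by $y = t v$ costs $t^m$ and
    makes the integrand independent of $t$, so that Tonelli's theorem leaves
    $\int_0^a (m + 1) t^m dt$ with $a = 1 / |(v, 1)|$. *)
Lemma ge0_integral_hemisphere m (H : 'rV[R]_m.+1 -> \bar R) :
  measurable_fun setT H -> (forall w, 0 <= H w) ->
  \int[@sphere_measure R m.+1]_(w in @hemisphere R m) H w =
  \int[lebesgue_rV R m]_v
    (H (direction (snoc (v, 1%R))) * ((enorm (snoc (v, 1%R))) ^- m.+1)%:E).
Proof.
move=> mH H0.
have mdir := @measurable_direction R m.+1.
have mHd : measurable_fun setT (fun y => H (direction y)).
  exact: (measurableT_comp mH mdir).
(* up to the factor m + 1, the surface measure is the image of the volume of the
   ball under direction *)
pose nu := measure_function_pushforward__canonical__measure_function_Measure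
  (mrestr (lebesgue_rV R m.+1) (@measurable_pointed_ball R m.+1)) mdir.
transitivity
  (\int[mscale (NngNum (ler0n R m.+1)) nu]_(w in @hemisphere R m) H w).
  by [].
rewrite (ge0_integral_mscale nu)//; last 2 first.
- exact: measurable_hemisphere.
- exact: measurable_funTS.
rewrite (ge0_integral_pushforward mdir)//; last 2 first.
- exact: measurable_hemisphere.
- exact: measurable_funTS.
rewrite ge0_integral_mrestr//; last 2 first.
- rewrite -[X in measurable X]setTI.
  apply: (@measurable_direction R m.+1) => //.
  exact: measurable_hemisphere.
- by move=> w; exact: H0.
rewrite direction_hemisphereE.
pose h (y : 'rV[R]_m.+1) :=
  if ((0 < y ord0 ord_max) && (enorm y <= 1))%R then H (direction y) else 0.
have h0 y : 0 <= h y by rewrite /h; case: ifP.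
have mh : measurable_fun setT h.
  apply: measurable_fun_ifT => //; apply: measurable_and.
    by apply: measurable_fun_ltr => //; exact: measurable_coord.
  by apply: measurable_fun_ler => //; exact: measurable_enorm.
rewrite integral_mkcond (eq_integral h); last first.
  move=> y _; rewrite /patch /h; case: ifPn => hy.
    by move: hy; rewrite inE/= => -[-> ->].
  by rewrite ifF//; apply: contraNF hy => /andP[? ?]; rewrite inE.
rewrite ge0_integral_rVS//.
pose E (v : 'rV[R]_m) := enorm (snoc (v, 1%R)).
have E0 v : (0 < E v)%R by exact: enorm_snoc1_gt0.
pose P (v : 'rV[R]_m) (t : R) : R :=
  (if 0 < t <= (E v)^-1 then t ^+ m else 0)%R.
have P0 v t : (0 <= P v t)%R.
  by rewrite /P; case: ifPn => // /andP[t0 _]; rewrite exprn_ge0// ltW.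
pose Phi (z : 'rV[R]_m * measurableTypeR R) :=
  H (direction (snoc (z.1, 1%R))) * (P z.1 z.2)%:E.
have Phi0 z : 0 <= Phi z by rewrite mule_ge0// lee_fin.
have mE : measurable_fun setT E.
  exact: (measurableT_comp (@measurable_enorm R m.+1)
    (@measurable_snocl R m 1%R)).
have mPhi : measurable_fun setT Phi.
  apply: emeasurable_funM.
    apply: (measurableT_comp
      (f := fun v => H (direction (snoc (v, 1%R))))) => //.
    exact: (measurableT_comp mHd (@measurable_snocl R m 1%R)).
  apply/measurable_EFinP; apply: measurable_fun_ifT => //.
    apply: measurable_and; first exact: measurable_fun_ltr.
    apply: measurable_fun_ler => //.
    have -> : (fun z : 'rV[R]_m * measurableTypeR R => (E z.1)^-1)%R =
              (fun z => E z.1 `^ (- 1))%R.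
      by apply/funext => z; rewrite powR_inv1// ltW.
    apply: (@measurableT_comp _ _ _ _ _ _ (@powR R ^~ (-1)%R)) => //.
    exact: measurableT_comp.
  exact: measurable_funX.
(* the slice at height t is scaled by y = t v; the ray through (v, 1) leaves the
   ball at height 1 / E v *)
transitivity (m.+1%:R%:E * \int[@lebesgue_measure R]_t
    \int[lebesgue_rV R m]_v Phi (v, t)).
  congr (_ * _); apply: eq_integral => t _.
  have [t0|t0] := leP t 0%R.
    rewrite !integral0_eq// => v _.
      by rewrite /Phi /P/= ltNge t0/= mule0.
    by rewrite /h snoc_last ltNge t0.
  rewrite (ge0_integral_affine 0%R (c := t)) ?gt_eqF//; last first.
    exact: (measurableT_comp mh (@measurable_snocl R m t)).
  rewrite -ge0_integralZl//; last first.
    exact: (measurableT_comp (measurableT_comp mh (@measurable_snocl R m t))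
      (measurable_shift_scale (0 : 'rV[R]_m)%R t)).
  apply: eq_integral => v _.
  rewrite add0r /Phi /P/= /h.
  have -> : snoc ((t *: v)%R, t) = (t *: snoc (v, 1%R))%R.
    by rewrite -snocZ mulr1.
  rewrite directionZ// enormZ mxE snoc_last mulr1 t0/= gtr0_norm//.
  have -> : (t * enorm (snoc (v, 1)) <= 1 = (t <= (E v)^-1))%R.
    by rewrite -[in RHS]div1r ler_pdivlMr.
  by case: ifP => _; rewrite ?mule0// muleC.
rewrite -(fubini_tonelli (m1 := lebesgue_rV R m) Phi)//.
rewrite -ge0_integralZl//; last 2 first.
- exact: (measurable_fun_fubini_tonelli_F (m2 := @lebesgue_measure R) Phi).
- by move=> v _; exact: integral_ge0.
apply: eq_integral => v _; rewrite /Phi/=.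
rewrite ge0_integralZl//; last 2 first.
- apply/measurable_EFinP; apply: measurable_fun_ifT => //.
    apply: measurable_and; first exact: measurable_fun_ltr.
    exact: measurable_fun_ler.
- by move=> t _; rewrite lee_fin.
rewrite integral_powers ?invr_gt0// muleCA -EFinM mulrCA mulfV// mulr1 exprVn//.
Qed.

End polar.

(** * Sharp coefficients of integral functionals *)

Section sharp_coefficient.
Context {R : realType} {m : nat}.
Implicit Types (p : \bar R) (f g h G : 'rV[R]_m -> R).
Local Notation mu := (lebesgue_rV R m).
Local Open Scope ereal_scope.

Lemma LfunP p f :
  f \in Lfun mu p <-> measurable_fun setT f /\ 'N[mu]_p[EFin \o f] < +oo.
Proof.
split=> [/andP[/set_mem ? /set_mem ?]|[? ?]]; first by [].
by apply/andP; split; exact/mem_set.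
Qed.

Lemma Lnorm_rE r f :
  'N[mu]_r%:E[EFin \o f] = (\int[mu]_y (`|f y| `^ r)%:E) `^ r^-1.
Proof. by rewrite unlock. Qed.

Lemma Lnorm_yE f :
  'N[mu]_+oo[EFin \o f] = ess_sup mu (abse \o (EFin \o f)).
Proof. by rewrite unlock/= lebesgue_rV_setT_gt0. Qed.

Lemma Lnorm_indic_box r (a : 'rV[R]_m) d : (0 < r)%R -> (0 < d)%R ->
  'N[mu]_r%:E[EFin \o (\1_(box a d) : _ -> R)] = mu (box a d) `^ r^-1.
Proof.
move=> r0 d0; rewrite Lnorm_rE; congr (_ `^ _).
rewrite -(setIT (box a d)) -integral_indic ?setIT//; last first.
  exact: measurable_box.
apply: eq_integral => y _; rewrite indicE.
by case: (_ \in _); rewrite ?normr1 ?powR1// normr0 powR0// gt_eqF.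
Qed.

(** A bound of a nonnegative functional can only be seen to be nonnegative on
    functions of positive norm; for the zero functional any such function will
    do, and there has to be one. *)
Lemma exists_Lnorm_gt0 p : 1 <= p ->
  exists h, [/\ measurable_fun setT h, (forall y, 0 <= h y)%R,
    'N[mu]_p[EFin \o h] < +oo & 0 < 'N[mu]_p[EFin \o h]].
Proof.
case: p => [r|_|//].
  rewrite lee_fin => r1; have r0 : (0 < r)%R by exact: lt_le_trans r1.
  exists (\1_(box 0%R 1%R)); rewrite Lnorm_indic_box// lebesgue_rV_box//.
  rewrite poweR_EFin ltry lte_fin powR_gt0 ?exprn_gt0 ?mulr1//; split => //.
  by apply: measurable_indic; exact: measurable_box.
exists (cst 1%R); rewrite Lnorm_yE; split => //.
all: rewrite (_ : abse \o _ = cst 1) ?ess_sup_cst ?ltry ?lebesgue_rV_setT_gt0//.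
all: by apply/funext => y /=; rewrite normr1.
Qed.

Lemma is_sharp_coefficient_eq p F F' (C : \bar R) :
  (forall f, f \in Lfun mu p -> F f = F' f) ->
  is_sharp_coefficient p F C -> is_sharp_coefficient p F' C.
Proof.
move=> FF' [c -> [cF lc]]; exists c => //; split.
  by move=> f /[dup] fL /cF; rewrite FF'.
by move=> d dF; apply: lc => f /[dup] fL /dF; rewrite FF'.
Qed.

Lemma bounds_ge0 p F c : 1 <= p -> (forall f, 0 <= F f)%R ->
  bounds p F c -> (0 <= c)%R.
Proof.
move=> p1 F0 cF; have [h [mh h0 hoo hgt0]] := exists_Lnorm_gt0 p1.
have hL : h \in Lfun mu p by exact/LfunP.
have : 0 <= c%:E * 'N[mu]_p[EFin \o h].
  by apply: le_trans (cF _ hL); rewrite lee_fin F0.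
by rewrite pmule_lge0.
Qed.

(** The case $a = 0$ is not a division: it says that the zero functional has
    sharp coefficient 0. *)
Lemma is_sharp_coefficientZ p F C (a : R) : 1 <= p -> (0 <= a)%R ->
  (forall f, 0 <= F f)%R -> is_sharp_coefficient p F C ->
  is_sharp_coefficient p (fun f => a * F f)%R (a%:E * C).
Proof.
move=> p1 a0 F0 [c -> [cF lc]]; exists (a * c)%R; rewrite ?EFinM//; split.
  by move=> f fL; rewrite EFinM EFinM -muleA lee_wpmul2l ?lee_fin//; exact: cF.
move=> d dF; move: a0; rewrite [(0 <= a)%R]le_eqVlt => /predU1P[a0|a0].
  rewrite -a0 mul0r; apply: (bounds_ge0 p1 _ dF) => f.
  by rewrite -a0 mul0r.
rewrite mulrC -ler_pdivlMr//; apply: lc => f fL.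
rewrite [(d / a)%R]mulrC EFinM -muleA lee_pdivlMl// -EFinM.
exact: dF.
Qed.

(** The norm of $L^q$, where $q = p / (p - 1)$ is the conjugate exponent, except
    that for $p = 1$ the supremum replaces the essential supremum; the two agree
    on continuous functions. *)
Definition dual_norm p G : \bar R :=
  match p with
  | r%:E => if r == 1%R then ereal_sup [set `|G y|%:E | y in setT]
            else (\int[mu]_y (`|G y| `^ (r / (r - 1)))%:E) `^ ((r - 1) / r)
  | _ => \int[mu]_y `|G y|%:E
  end.

Lemma dual_norm_ge0 p G : 0 <= dual_norm p G.
Proof.
case: p => [r||]; rewrite /dual_norm; try by exact: integral_ge0.
case: ifP => _; last exact: poweR_ge0.
apply: (@le_trans _ _ `|G 0%R|%:E); first by rewrite lee_fin.
by apply: ereal_sup_ubound; exists 0%R.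
Qed.

(** Hoelder's inequality; at the endpoints one factor is replaced by its
    supremum or essential supremum. *)
Lemma le_pairing p G f : 1 <= p -> measurable_fun setT G ->
  dual_norm p G < +oo -> f \in Lfun mu p ->
  \int[mu]_y `|(G y * f y)%:E| <= dual_norm p G * 'N[mu]_p[EFin \o f].
Proof.
move=> p1 mG Goo /LfunP[mf foo].
rewrite -[leLHS](Lnorm1 mu (EFin \o (fun y => G y * f y)%R)).
case: p p1 Goo foo => [r|_|//]; rewrite /dual_norm.
  case: eqVneq => [-> _|r1].
    rewrite !Lnorm1 => Goo _.
    have G0 := dual_norm_ge0 1 G; rewrite /dual_norm eqxx in G0.
    rewrite -ge0_integralZl//; last first.
      by apply/measurable_EFinP; exact: measurableT_comp.
    apply: ge0_le_integral => //.
    - apply/measurable_EFinP; apply: measurableT_comp => //.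
      exact: measurable_funM.
    - apply: emeasurable_funM => //; apply/measurable_EFinP.
      exact: measurableT_comp.
    - move=> y _ /=; rewrite normrM EFinM lee_wpmul2r ?lee_fin//.
      by apply: ereal_sup_ubound; exists y.
  rewrite lee_fin => r1' _ _.
  have {r1 r1'} r1 : (1 < r)%R by rewrite lt_neqAle eq_sym r1.
  have r0 : (0 < r)%R by exact: lt_trans r1.
  have q0 : (0 < r / (r - 1))%R by rewrite divr_gt0// subr_gt0.
  have := @hoelder _ _ _ mu G f (r / (r - 1))%R r mG mf q0 r0.
  rewrite [X in X * _]Lnorm_rE invf_div; apply.
  by field; rewrite gt_eqF//= gt_eqF// subr_gt0.
move=> Goo foo.
have N0 := Lnorm_ge0 mu +oo (EFin \o f).
have aef : {ae mu, forall y, `|(f y)%:E| <= 'N[mu]_+oo[EFin \o f]}.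
  by rewrite Lnorm_yE; exact: ess_sup_ge.
move: N0 foo aef; case: ('N[mu]_+oo[EFin \o f]) => [M|//|//] M0 _ aef.
rewrite Lnorm1 -ge0_integralZr//; last first.
  by apply/measurable_EFinP; exact: measurableT_comp.
apply: ae_ge0_le_integral => //.
- apply/measurable_EFinP; apply: measurableT_comp => //.
  exact: measurable_funM.
- by move=> y _; rewrite mule_ge0.
- apply: emeasurable_funM => //; apply/measurable_EFinP.
  exact: measurableT_comp.
- apply: filterS aef => y fy _ /=; rewrite normrM EFinM lee_wpmul2l ?lee_fin//.
Qed.

Lemma integrable_pairing p G f : 1 <= p -> measurable_fun setT G ->
  dual_norm p G < +oo -> f \in Lfun mu p ->
  mu.-integrable setT (EFin \o (fun y => G y * f y)%R).
Proof.
move=> p1 mG Goo fL; have [mf foo] := (LfunP p f).1 fL.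
apply/integrableP; split.
  by apply/measurable_EFinP; exact: measurable_funM.
apply: le_lt_trans (le_pairing p1 mG Goo fL) _.
by rewrite lte_mul_pinfty ?ge0_fin_numE ?dual_norm_ge0.
Qed.

Definition pairing G f : R := `|\int[mu]_y (G y * f y)|%R.

(** Testing with $f = h\, \mathrm{sign} (G)$ turns $G f$ into $|G| h$ and
    $|f|$ into $h$. *)
Lemma bounds_pairing_le p G h c : 1 <= p -> measurable_fun setT G ->
  dual_norm p G < +oo -> measurable_fun setT h -> (forall y, 0 <= h y)%R ->
  'N[mu]_p[EFin \o h] < +oo -> bounds p (pairing G) c ->
  \int[mu]_y (`|G y| * h y)%:E <= c%:E * 'N[mu]_p[EFin \o h].
Proof.
move=> p1 mG Goo mh h0 hoo cG.
pose f y := (h y * (if G y < 0 then -1 else 1))%R.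
have mf : measurable_fun setT f.
  apply: measurable_funM => //; apply: measurable_fun_ifT => //.
  exact: measurable_fun_ltr.
have absf y : `|f y|%R = h y.
  by rewrite /f normrM ger0_norm//; case: ifP; rewrite ?normrN1 ?normr1 mulr1.
have Nf : 'N[mu]_p[EFin \o f] = 'N[mu]_p[EFin \o h].
  rewrite -[LHS]Lnorm_abse; congr Lnorm; apply/funext => y /=.
  by rewrite absf.
have fL : f \in Lfun mu p by apply/LfunP; rewrite Nf.
have GfE y : (G y * f y = `|G y| * h y)%R.
  rewrite /f mulrCA mulrC; congr (_ * _)%R; case: ltP => G0.
    by rewrite mulrN1 ltr0_norm.
  by rewrite mulr1 ger0_norm.
have := cG _ fL; rewrite Nf /pairing EFin_normr_Rintegral//; last first.
  exact: (integrable_pairing p1 mG Goo fL).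
rewrite gee0_abs; last first.
  by apply: integral_ge0 => y _; rewrite lee_fin GfE mulr_ge0.
by under eq_integral do rewrite GfE.
Qed.

Lemma continuous_norm_box G (y0 : 'rV[R]_m) (e : R) : (0 < e)%R ->
  {for y0, continuous G} ->
  exists2 d : R, (0 < d)%R &
    forall y, box y0 d y -> (`|G y0| - e <= `|G y|)%R.
Proof.
move=> e0 /cvgrPdist_lt /(_ e e0) /nbhs_ballP [d /= d0 dG].
exists (d / 2)%R; first by rewrite divr_gt0.
move=> y yd; have := dG y; rewrite /= => H.
have /ltW : (`|G y0 - G y| < e)%R.
  apply: H; split => // i j; rewrite /ball/= ord1 distrC.
  by rewrite (le_lt_trans (yd j))// ltr_pdivrMr// ltr_pMr// ltr1n.
by rewrite lerBlDl -lerBlDr; apply: le_trans; exact: lerB_dist.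
Qed.

(** Converse of Hoelder's inequality: the functional $f \mapsto \int G f$ has
    norm [dual_norm p G]. *)
Lemma pairing_sharp p G : 1 <= p -> measurable_fun setT G -> continuous G ->
  dual_norm p G < +oo -> is_sharp_coefficient p (pairing G) (dual_norm p G).
Proof.
move=> p1 mG cG Goo.
have Gfin : dual_norm p G \is a fin_num by rewrite ge0_fin_numE ?dual_norm_ge0.
exists (fine (dual_norm p G)); rewrite ?fineK//; split.
  move=> f fL; rewrite fineK// EFin_normr_Rintegral//; last first.
    exact: (integrable_pairing p1 mG Goo fL).
  apply: le_trans (le_pairing p1 mG Goo fL).
  apply: le_abse_integral => //.
  by have /integrableP[] := integrable_pairing p1 mG Goo fL.
move=> c cc; rewrite -lee_fin fineK//.
have c0 : (0 <= c)%R by apply: (bounds_ge0 p1 _ cc) => f; exact: normr_ge0.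
have test (h : 'rV[R]_m -> R) (mh : measurable_fun setT h)
    (h0 : forall y, (0 <= h y)%R) (hoo : 'N[mu]_p[EFin \o h] < +oo) :=
  bounds_pairing_le p1 mG Goo mh h0 hoo cc.
(* p = oo: h = 1 *)
case: p p1 Goo Gfin cc test => [r|_|//]; rewrite /dual_norm; last first.
  move=> _ _ _ /(_ (cst 1%R)).
  rewrite Lnorm_yE (_ : abse \o _ = cst 1); last first.
    by apply/funext => y /=; rewrite normr1.
  rewrite ess_sup_cst ?lebesgue_rV_setT_gt0// ltry mule1 => /(_ _ _ isT).
  under eq_integral do rewrite /= mulr1.
  by apply.
(* p = 1: the average of |G| over small boxes around y0 tends to |G y0| *)
case: eqVneq => [-> _ _ _ _ test|r1].
  apply: ge_ereal_sup => _ [y0 _ <-]; rewrite lee_fin.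
  apply/ler_addgt0Pl => e e0.
  have [d d0 Gd] := continuous_norm_box e0 (cG y0).
  have c20 : (0 < (2 * d) ^+ m)%R by rewrite exprn_gt0// mulr_gt0.
  have mc := measurable_box y0 d.
  have mi : measurable_fun setT (\1_(box y0 d) : 'rV[R]_m -> R).
    exact: measurable_indic.
  have i0 y : (0 <= \1_(box y0 d) y :> R)%R by rewrite indicE.
  have := test _ mi i0.
  have -> : 'N[mu]_1[EFin \o (\1_(box y0 d) : _ -> R)] = ((2 * d) ^+ m)%:E.
    rewrite Lnorm_indic_box// lebesgue_rV_box// invr1 poweRe1// lee_fin.
    exact: ltW.
  rewrite ltry => /(_ isT) Gc.
  have [Ge|Ge] := leP (`|G y0| - e)%R 0%R.
    lra.
  rewrite -lerBlDl -lee_fin -(@lee_pmul2r _ ((2 * d) ^+ m)%:E) ?lte_fin//.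
  apply: le_trans Gc.
  rewrite -(lebesgue_rV_box y0 d0) -[X in mu X]setIT -integral_indic//.
  rewrite -ge0_integralZl_EFin//; [|exact/measurable_EFinP|exact: ltW].
  apply: ge0_le_integral => //.
  - by move=> y _; rewrite mule_ge0// lee_fin ltW.
  - by apply: measurable_funeM; exact/measurable_EFinP.
  - apply/measurable_EFinP; apply: measurable_funM => //.
    exact: measurableT_comp.
  - move=> y _; rewrite -EFinM lee_fin indicE.
    case: (boolP (y \in box y0 d)) => [|_]; last by rewrite !mulr0.
    by rewrite !mulr1 inE => /Gd.
(* 1 < p < oo: for h = |G|^(q-1) both sides are powers of the integral of
   |G|^q *)
rewrite lee_fin => r1' Goo _ _ test.
have {r1 r1'} r1 : (1 < r)%R by rewrite lt_neqAle eq_sym r1.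
have r0 : (0 < r)%R by exact: lt_trans r1.
have r10 : (0 < r - 1)%R by rewrite subr_gt0.
set q := (r / (r - 1))%R in Goo *.
have q0 : (0 < q)%R by rewrite divr_gt0.
have qE : (q - 1 = (r - 1)^-1)%R by rewrite /q; field; rewrite gt_eqF.
pose h (y : 'rV[R]_m) : R := (`|G y| `^ (q - 1))%R.
have mh : measurable_fun setT h.
  apply: (@measurableT_comp _ _ _ _ _ _ (@powR R ^~ (q - 1)%R)) => //.
  exact: measurableT_comp.
have hr y : (`|h y| `^ r = `|G y| `^ q)%R.
  by rewrite ger0_norm ?powR_ge0// -powRrM qE mulrC.
have Gh y : (`|G y| * h y = `|G y| `^ q)%R by exact: mulr_powRB1.
have := test h mh (fun y => powR_ge0 _ _).
rewrite Lnorm_rE.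
have -> : \int[mu]_y (`|h y| `^ r)%:E = \int[mu]_y (`|G y| `^ q)%:E.
  by apply: eq_integral => y _; rewrite hr.
have -> : \int[mu]_y (`|G y| * h y)%:E = \int[mu]_y (`|G y| `^ q)%:E.
  by apply: eq_integral => y _; rewrite Gh.
have I0 : 0 <= \int[mu]_y (`|G y| `^ q)%:E.
  by apply: integral_ge0 => y _; rewrite lee_fin powR_ge0.
have Ioo : \int[mu]_y (`|G y| `^ q)%:E < +oo.
  have := poweR_lty ((r - 1) / r)^-1 Goo.
  by rewrite -poweRrM mulfV ?poweRe1// mulf_neq0 ?invr_neq0 ?gt_eqF.
move: I0 Ioo; case: (\int[mu]_y _) => [i|//|//]; rewrite lee_fin => i0 _.
rewrite !poweR_EFin ltry => /(_ isT); rewrite -EFinM !lee_fin.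
move: i0; rewrite le_eqVlt => /orP[/eqP <- _|i0 ic].
  by rewrite powR0// mulf_neq0 ?invr_neq0 ?gt_eqF.
rewrite -(ler_pM2r (powR_gt0 r^-1 i0)); apply: le_trans ic.
rewrite -powRD; last by rewrite (gt_eqF i0)/= implybT.
have -> : ((r - 1) / r + r^-1 = 1)%R by field; rewrite gt_eqF.
by rewrite powRr1// ltW.
Qed.

(** The norm of a vector is the supremum of its components along unit vectors,
    so a constant bounds the norm if and only if it bounds all components. *)
Lemma is_sharp_coefficient_enorm n p
    (g : ('rV[R]_m -> R) -> 'rV[R]_n.+1) (C : 'rV[R]_n.+1 -> \bar R) :
  1 <= p ->
  (forall z, enorm z = 1%R ->
    is_sharp_coefficient p (fun f => `|dot (g f) z|%R) (C z)) ->
  is_sharp_coefficient p (fun f => enorm (g f))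
    (ereal_sup [set C z | z in @esphere R n.+1]).
Proof.
move=> p1 gC; set S := ereal_sup _.
have c_ z : enorm z = 1%R -> exists c, [/\ C z = c%:E, (0 <= c)%R,
    bounds p (fun f => `|dot (g f) z|%R) c
    & lbound (bounds p (fun f => `|dot (g f) z|%R)) c].
  move=> z1; have [c Cc [cb cl]] := gC z z1; exists c; split=> //.
  by apply: (bounds_ge0 p1 _ cb) => f; exact: normr_ge0.
(* |(g f, z)| <= sum_i |(g f, e_i)|, so that B bounds all the C z *)
pose B := \sum_(i < n.+1) C (delta_mx ord0 i).
have N0 f : 0 <= 'N[mu]_p[EFin \o f] by exact: Lnorm_ge0.
have CB z : enorm z = 1%R -> C z <= B.
  move=> z1; have [c [-> c0 _ cl]] := c_ z z1.
  have Ci i : C (delta_mx ord0 i) \is a fin_num.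
    by have [d [->]] := c_ _ (enorm_delta i).
  have BE : B = (\sum_(i < n.+1) fine (C (delta_mx ord0 i)))%:E.
    by rewrite -sumEFin; apply: eq_bigr => i _; rewrite fineK.
  rewrite BE lee_fin; apply: cl => f fL.
  apply: (@le_trans _ _ (\sum_(i < n.+1) `|dot (g f) (delta_mx ord0 i)|%:E)).
    rewrite sumEFin lee_fin (le_trans (ler_norm_sum _ _ _))//.
    apply: ler_sum => i _.
    rewrite dot_delta normrM ler_piMr// -z1; exact: ler_coord_enorm.
  rewrite -sumEFin ge0_sume_distrl; last first.
    by move=> i _; have [d [->]] := c_ _ (enorm_delta i).
  apply: lee_sum => i _; rewrite fineK//.
  by have [d [-> _ + _]] := c_ _ (enorm_delta i); exact.
have Bfin : B \is a fin_num.
  apply/sum_fin_numP => i _ _.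
  by have [d [->]] := c_ _ (enorm_delta i).
have SB : S <= B by apply: ge_ereal_sup => _ [z z1 <-]; exact: CB.
have CS z : enorm z = 1%R -> C z <= S.
  by move=> z1; apply: ereal_sup_ubound; exists z.
have S0 : 0 <= S.
  apply: le_trans (CS _ (enorm_delta ord0)).
  by have [d [->]] := c_ _ (enorm_delta ord0).
have Sfin : S \is a fin_num.
  by rewrite ge0_fin_numE// (le_lt_trans SB)// -ge0_fin_numE// (le_trans S0).
exists (fine S); rewrite ?fineK//; split.
  move=> f fL; rewrite fineK//.
  have [->|g0] := eqVneq (enorm (g f)) 0%R; first by rewrite mule_ge0.
  have gp : (0 < enorm (g f))%R by rewrite lt_neqAle eq_sym g0 enorm_ge0.
  (* the inequality is attained at the direction of g f *)
  have z1 := enorm_direction gp.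
  have [c [Cc c0 cb _]] := c_ _ z1.
  have -> : enorm (g f) = `|dot (g f) (direction (g f))|%R.
    rewrite /direction dotZr -sqr_enorm expr2 mulKf// ger0_norm//.
    exact: enorm_ge0.
  by rewrite (le_trans (cb _ fL))// -Cc lee_wpmul2r// CS.
move=> d db; rewrite -lee_fin fineK//; apply: ge_ereal_sup => _ [z z1 <-].
have [c [-> _ _ cl]] := c_ z z1; rewrite lee_fin; apply: cl => f fL.
by apply: le_trans (db f fL); rewrite lee_fin dotC ler_dot_enorm.
Qed.

End sharp_coefficient.

(** * The kernel and its derivative *)

Section kernel.
Context {R : realType} {m : nat}.
Variables (alpha beta : R).
Implicit Types (x z v w : 'rV[R]_m.+1) (y : 'rV[R]_m).

Definition sight x y : 'rV[R]_m.+1 := direction (x - snoc (y, 0)).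

(** The sine of the angle between the line of sight from $(y, 0)$ to $x$ and
    the boundary hyperplane. *)
Definition elevation x y : R := dot (sight x y) (e_n R m).

(** The angular factor, through which the derivative of the integrand depends
    on $y$. *)
Definition kernel x z y : R :=
  elevation x y `^ beta *
  dot (alpha *: e_n R m - elevation x y *: sight x y) z.

Lemma sub_snoc_last x y : (x - snoc (y, 0)) ord0 ord_max = x ord0 ord_max.
Proof. by rewrite mxE mxE snoc_last subr0. Qed.

Lemma dist_ge_height x y : `|x ord0 ord_max| <= enorm (x - snoc (y, 0)).
Proof. by rewrite -[in leLHS](sub_snoc_last x y); exact: ler_coord_enorm. Qed.

Lemma dist_gt0 x y : 0 < x ord0 ord_max -> 0 < enorm (x - snoc (y, 0)).
Proof.
by move=> x0; apply: (enorm_gt0 (i := ord_max)); rewrite sub_snoc_last gt_eqF.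
Qed.

Lemma elevationE x y :
  elevation x y = x ord0 ord_max / enorm (x - snoc (y, 0)).
Proof.
by rewrite /elevation /e_n dot_delta /sight /direction mxE sub_snoc_last mulrC.
Qed.

Lemma elevation_gt0 x y : 0 < x ord0 ord_max -> 0 < elevation x y.
Proof. by move=> x0; rewrite elevationE divr_gt0// dist_gt0. Qed.

Lemma elevation_le1 x y : 0 < x ord0 ord_max -> elevation x y <= 1.
Proof.
move=> x0; rewrite elevationE ler_pdivrMr ?dist_gt0// mul1r.
exact: le_trans (ler_norm _) (dist_ge_height x y).
Qed.

Lemma enorm_sight x y : 0 < x ord0 ord_max -> enorm (sight x y) = 1.
Proof. by move=> x0; apply: enorm_direction; exact: dist_gt0. Qed.

Lemma kernelE x z y : kernel x z y = elevation x y `^ beta *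
  (alpha * z ord0 ord_max - elevation x y * dot (sight x y) z).
Proof. by rewrite /kernel dotBl !dotZl /e_n (dotC _ z) dot_delta. Qed.

Lemma dot_sight x z y :
  dot (sight x y) z = (enorm (x - snoc (y, 0)))^-1 * dot (x - snoc (y, 0)) z.
Proof. exact: dotZl. Qed.

Lemma norm_kernel_le x z y : 0 <= alpha -> 0 < x ord0 ord_max -> enorm z <= 1 ->
  `|kernel x z y| <= (alpha + 1) * elevation x y `^ beta.
Proof.
move=> a0 x0 z1; rewrite normrM ger0_norm ?powR_ge0// mulrC.
rewrite ler_wpM2r ?powR_ge0//.
move: (sight x y) (enorm_sight y x0) (elevation_le1 y x0) => u u1 e1.
rewrite dotBl !dotZl /e_n dotC dot_delta.
have e0 := ltW (elevation_gt0 y x0).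
rewrite (le_trans (ler_normB _ _))// !normrM lerD//.
  rewrite (ger0_norm a0) ler_piMr// (le_trans (ler_coord_enorm z _))//.
rewrite (ger0_norm e0) mulr_ile1//.
exact: le_trans (ler_dot_enorm _ _) z1.
Qed.

(** Linearity in the direction passes from the coordinate derivatives, which
    make up the gradient, to an arbitrary direction. *)
Lemma kernel_sum x z y :
  kernel x z y = \sum_i z ord0 i * kernel x (delta_mx ord0 i) y.
Proof.
rewrite /kernel; set u := (_ - _); rewrite {1}/dot mulr_sumr.
by apply: eq_bigr => i _; rewrite dot_delta; ring.
Qed.

Lemma integrandE (f : 'rV[R]_m -> R) x y : 0 < x ord0 ord_max ->
  integrand alpha beta f x y =
  x ord0 ord_max `^ (beta * (alpha - 1)) * (elevation x y `^ beta * f y).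
Proof.
move=> x0; rewrite /integrand -[in enorm _]opprB enormN.
have r0 := dist_gt0 y x0.
rewrite elevationE mulrA; congr (_ * _).
rewrite !powRM ?powR_ge0 ?invr_ge0 ?(ltW x0) ?(ltW r0)// mulrA; congr (_ * _).
rewrite -powRrM -powRD; last by rewrite (gt_eqF x0)/= implybT.
by congr (_ `^ _); ring.
Qed.

(** The logarithmic derivative of $x_n^\alpha / |x - y|$ in direction $v$ is
    $\alpha v_n / x_n - (x - y, v) / |x - y|^2$. *)
Lemma is_derive_integrand (f : 'rV[R]_m -> R) x v y (t : R) :
  0 < (t *: v + x) ord0 ord_max ->
  is_derive t 1 (fun h => integrand alpha beta f (h *: v + x) y)
    (beta * (t *: v + x) ord0 ord_max `^ (beta * (alpha - 1) - 1) *
     (kernel (t *: v + x) v y * f y)).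
Proof.
move=> x0; set X := (t *: v + x) ord0 ord_max in x0 *.
set s := t *: v + x - snoc (y, 0).
have r0 : 0 < enorm s by exact: dist_gt0.
(* along the line, the height is affine and the squared distance is quadratic *)
pose c0 := x ord0 ord_max; pose c1 := v ord0 ord_max.
pose s0 := x - snoc (y, 0).
pose D (h : R) := dot s0 s0 + (2 * dot s0 v + dot v v * h) * h.
have DE h : enorm (snoc (y, 0) - (h *: v + x)) = Num.sqrt (D h).
  rewrite -opprB enormN /enorm; congr Num.sqrt.
  by rewrite -addrA -/s0 dot_line.
have XE h : (h *: v + x) ord0 ord_max = c1 * h + c0.
  by rewrite !mxE mulrC.
have Xt : c1 * t + c0 = X by rewrite -XE.
have Dt : Num.sqrt (D t) = enorm s by rewrite -DE -opprB enormN.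
pose q (h : R) := (c1 * h + c0) `^ alpha * (Num.sqrt (D h))^-1.
rewrite (_ : (fun h => _) = (fun h => (q h) `^ beta * f y)); last first.
  by apply/funext => h; rewrite /integrand DE XE.
have did (g : R -> R) (a b : R) : g = (fun h => a * h + b) -> is_derive t 1 g a.
  move=> ->; have := is_deriveD
    (is_deriveM (is_derive_cst a t 1) (is_derive_id t (1 : R)))
    (is_derive_cst b t (1 : R)).
  by move=> /is_derive_eq; apply; rewrite scaler0 !addr0; exact: mulr1.
have dX : is_derive t 1 (fun h => c1 * h + c0) c1 by exact: did.
have dD : is_derive t 1 D (2 * dot s v).
  have d1 : is_derive t 1 (fun h => 2 * dot s0 v + dot v v * h) (dot v v).
    by apply: (did _ _ (2 * dot s0 v)); apply/funext => h; rewrite addrC.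
  have := is_deriveD (is_derive_cst (dot s0 s0) t 1)
    (is_deriveM d1 (is_derive_id t (1 : R))).
  move=> /is_derive_eq; apply; rewrite add0r /GRing.scale/= mulr1.
  have -> : s = t *: v + s0 by rewrite /s -addrA.
  by rewrite (dotDl (t *: v) s0 v) dotZl; ring.
have dXa : is_derive t 1 (fun h => (c1 * h + c0) `^ alpha)
    (alpha * X `^ (alpha - 1) * c1).
  rewrite -Xt; apply: (@is_derive1_comp R (@powR R ^~ alpha)) => //.
  by apply: is_derive1_powR; rewrite Xt.
have Dgt0 : 0 < D t by rewrite -sqrtr_gt0 Dt.
have dS : is_derive t 1 (fun h => (Num.sqrt (D h))^-1)
    (- (enorm s ^- 3) * dot s v).
  have := @is_derive1_comp R Num.sqrt D t _ _ (is_derive1_sqrt Dgt0) dD.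
  rewrite Dt => d1.
  have := @is_deriveV R (Num.sqrt \o D) t _ 1 _ d1.
  rewrite /= Dt gt_eqF// => /(_ isT) /is_derive_eq; apply.
  by rewrite /GRing.scale/=; field; rewrite gt_eqF.
(* logarithmic derivative of q *)
have dq : is_derive t 1 q (q t * (alpha * c1 / X - dot s v / enorm s ^+ 2)).
  have := is_deriveM dXa dS.
  move=> /is_derive_eq; apply; rewrite /GRing.scale/= /q Dt Xt.
  have -> : X `^ (alpha - 1) = X `^ alpha / X.
    by rewrite powRB ?powRr1// ?(ltW x0)// (gt_eqF x0) implybT.
  by field; rewrite !gt_eqF.
have q0 : 0 < q t.
  by rewrite mulr_gt0 ?powR_gt0 ?Xt// invr_gt0 Dt.
have dqb := @is_derive1_comp R (@powR R ^~ beta) q t _ _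
  (is_derive1_powR beta q0) dq.
have := is_deriveM dqb (is_derive_cst (f y) t 1).
move=> /is_derive_eq; apply.
have qE : q t `^ beta =
    X `^ (beta * (alpha - 1)) * elevation (t *: v + x) y `^ beta.
  have := integrandE (fun=> 1) y x0.
  by rewrite /integrand DE -/X !mulr1 /q Xt.
have -> : q t `^ (beta - 1) = q t `^ beta / q t.
  by rewrite powRB ?powRr1// ?(ltW q0)// (gt_eqF q0) implybT.
have -> : X `^ (beta * (alpha - 1) - 1) = X `^ (beta * (alpha - 1)) / X.
  by rewrite powRB ?powRr1// ?(ltW x0)// (gt_eqF x0) implybT.
rewrite scaler0 add0r /GRing.scale/= qE kernelE dot_sight elevationE.
rewrite -/s -/X -/c1.
field.
by rewrite !gt_eqF.
Qed.

End kernel.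

(** * The conjugate norm of the kernel in spherical coordinates *)

Section kernel_norm.
Context {R : realType} {m : nat}.
Variables (alpha beta : R).
Implicit Types (x z v w : 'rV[R]_m.+1) (y : 'rV[R]_m) (p : \bar R).
Local Notation mu := (lebesgue_rV R m).

Lemma measurable_dot n (z : 'rV[R]_n) :
  measurable_fun setT (fun w : 'rV[R]_n => dot w z).
Proof.
apply: measurable_sum => i; apply: measurable_funM => //.
exact: measurable_coord.
Qed.

Lemma measurable_sight x : measurable_fun setT (sight x).
Proof.
apply: (measurableT_comp (@measurable_direction R m.+1)).
rewrite (_ : (fun y => _) = (fun w => x + (-1) *: w) \o (fun y => snoc (y, 0))).
  apply: (measurableT_comp (measurable_shift_scale x (-1))).
  exact: (@measurable_snocl R m 0).
by apply/funext => y /=; rewrite scaleN1r.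
Qed.

Lemma measurable_elevation x : measurable_fun setT (elevation x).
Proof. exact: (measurableT_comp (measurable_dot _) (measurable_sight x)). Qed.

Lemma measurable_powR_comp d (T : measurableType d) (f : T -> R) (b : R) :
  measurable_fun setT f -> measurable_fun setT (fun t => f t `^ b).
Proof. exact: (@measurableT_comp _ _ _ _ _ _ (@powR R ^~ b)). Qed.

Lemma measurable_kernel x z : measurable_fun setT (kernel alpha beta x z).
Proof.
rewrite (_ : kernel _ _ _ _ = fun y => elevation x y `^ beta *
    (alpha * z ord0 ord_max - elevation x y * dot (sight x y) z)); last first.
  by apply/funext => y; rewrite kernelE.
apply: measurable_funM.
  exact: (measurable_powR_comp _ (measurable_elevation x)).
apply: measurable_funB => //; apply: measurable_funM.
  exact: measurable_elevation.
exact: (measurableT_comp (measurable_dot _) (measurable_sight x)).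
Qed.

Lemma continuous_kernel x z : 0 < x ord0 ord_max ->
  continuous (kernel alpha beta x z).
Proof.
move=> x0 y0.
have cdot (u : 'rV[R]_m -> 'rV[R]_m.+1) (w : 'rV[R]_m -> 'rV[R]_m.+1) :
    (forall i, {for y0, continuous (fun y => u y ord0 i)}) ->
    (forall i, {for y0, continuous (fun y => w y ord0 i)}) ->
    {for y0, continuous (fun y => dot (u y) (w y))}.
  move=> cu cw; apply: cvg_big => [|| i _]; first exact: add_continuous.
    exact: nbhs_filter.
  exact: (cvgM (cu i) (cw i)).
have cs i : {for y0, continuous (fun y => (x - snoc (y, 0)) ord0 i)}.
  rewrite (_ : (fun y => _) =
    fun y => x ord0 i - snoc (y, 0) ord0 i); last first.
    by apply/funext => y; rewrite !mxE.
  apply: continuousB; first exact: cst_continuous.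
  rewrite (_ : (fun y => _) = fun y => snoc (y, 0) ord0 i)//.
  case: (unliftP ord_max i) => [j ->|->].
    rewrite (_ : (fun y => _) = fun y : 'rV[R]_m => y ord0 j); last first.
      by apply/funext => y; rewrite mxE liftK.
    exact: coord_continuous.
  rewrite (_ : (fun y => _) = fun=> 0); first exact: cst_continuous.
  by apply/funext => y; rewrite snoc_last.
have cr : {for y0, continuous (fun y => (enorm (x - snoc (y, 0)))^-1)}.
  apply: continuousV; first by rewrite gt_eqF// dist_gt0.
  apply: (continuous_comp (g := Num.sqrt)); first exact: cdot.
  exact: sqrt_continuous.
have ce : {for y0, continuous (elevation x)}.
  rewrite (_ : elevation x = fun y => x ord0 ord_max / enorm (x - snoc (y, 0))).
    by apply: continuousM => //; exact: cst_continuous.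
  by apply/funext => y; rewrite elevationE.
suff : {for y0, continuous (kernel alpha beta x z)} by [].
rewrite (_ : kernel _ _ _ _ = fun y => elevation x y `^ beta *
    (alpha * z ord0 ord_max - elevation x y *
      ((enorm (x - snoc (y, 0)))^-1 * dot (x - snoc (y, 0)) z))); last first.
  by apply/funext => y; rewrite kernelE dot_sight.
apply: continuousM.
  apply: (continuous_comp (g := fun t => powR t beta)) => //.
  have [/derivable1_diffP/differentiable_continuous + _] :=
    is_derive1_powR beta (elevation_gt0 y0 x0).
  exact.
apply: continuousB; first exact: cst_continuous.
apply: continuousM => //; apply: continuousM => //; apply: cdot => // i.
exact: cst_continuous.
Qed.

(** In the coordinate $v$ with $y = x' - x_n v$, lines of sight are given by the
    gnomonic projection. *)
Lemma sight_affine x y : 0 < x ord0 ord_max ->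
  sight x ((unsnoc x).1 + (- x ord0 ord_max) *: y) = direction (snoc (y, 1)).
Proof.
move=> x0; rewrite -[RHS](directionZ _ x0) /sight; congr direction.
apply/rowP => i; rewrite !mxE; case: unliftP => [j|] -> /=; rewrite ?mxE; ring.
Qed.

Lemma dot_direction_snoc1 y :
  dot (direction (snoc (y, 1))) (e_n R m) = (enorm (snoc (y, 1)))^-1.
Proof. by rewrite /e_n dot_delta mxE snoc_last mulr1. Qed.

Local Open Scope ereal_scope.

Lemma ge0_integral_sight x (f : 'rV[R]_m.+1 -> \bar R) :
  (0 < x ord0 ord_max)%R -> measurable_fun setT f -> (forall w, 0 <= f w) ->
  \int[mu]_y f (sight x y) = (x ord0 ord_max ^+ m)%:E *
    \int[mu]_y f (direction (snoc (y, 1%R))).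
Proof.
move=> x0 mf f0.
have c0 : (- x ord0 ord_max != 0)%R by rewrite oppr_eq0 gt_eqF.
have mfs := measurableT_comp mf (measurable_sight x).
rewrite (ge0_integral_affine (unsnoc x).1 c0 mfs (fun y => f0 _)).
rewrite normrN gtr0_norm//; congr (_ * _); apply: eq_integral => y _ /=.
by rewrite sight_affine.
Qed.

(** Under $y \mapsto w$ the Lebesgue measure becomes
    $x_n^m w_n^{-(m+1)} d\sigma$. *)
Lemma ge0_integral_sight_sphere x (f : 'rV[R]_m.+1 -> \bar R) :
  (0 < x ord0 ord_max)%R -> measurable_fun setT f -> (forall w, 0 <= f w) ->
  \int[mu]_y f (sight x y) = (x ord0 ord_max ^+ m)%:E *
    \int[@sphere_measure R m.+1]_(w in @hemisphere R m)
      (f w * (dot w (e_n R m) `^ (- m.+1%:R))%:E).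
Proof.
move=> x0 mf f0; rewrite ge0_integral_sight//; congr (_ * _).
rewrite ge0_integral_hemisphere; last 2 first.
- apply: emeasurable_funM => //; apply/measurable_EFinP.
  exact: (measurable_powR_comp _ (measurable_dot _)).
- by move=> w; rewrite mule_ge0// lee_fin powR_ge0.
apply: eq_integral => y _; rewrite -muleA -EFinM dot_direction_snoc1.
have E0 := enorm_snoc1_gt0 y.
rewrite powR_invn ?invr_ge0 ?ltW// exprVn invrK mulfV ?mule1//.
by rewrite expf_neq0// gt_eqF.
Qed.

(** In the coordinate $v$ with $y = x' - x_n v$ the elevation is
    $(1 + |v|^2)^{-1/2}$. *)
Lemma integral_elevation_lty x (s : R) : (0 < x ord0 ord_max)%R ->
  (m%:R < s)%R -> \int[mu]_y (elevation x y `^ s)%:E < +oo.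
Proof.
move=> x0 ms.
have mf : measurable_fun [set: 'rV[R]_m.+1]
    (fun w => (dot w (e_n R m) `^ s)%:E).
  apply/measurable_EFinP; exact: (measurable_powR_comp _ (measurable_dot _)).
rewrite (ge0_integral_sight x0 mf); last by move=> w; rewrite lee_fin powR_ge0.
rewrite lte_mul_pinfty ?lee_fin ?exprn_ge0 ?(ltW x0)//.
rewrite (_ : integral _ _ _ =
  \int[mu]_y ((1 + dot y y) `^ (- (s / 2)))%:E).
  exact: integral_bracket_lty.
apply: eq_integral => y _; rewrite dot_direction_snoc1; congr (_%:E).
have D0 : (0 <= 1 + dot y y)%R by rewrite addr_ge0 ?dot_ge0.
rewrite /enorm dot_snoc mulr1 addrC -powR12_sqrt// -powR_inv1 ?powR_ge0//.
by rewrite -!powRrM; congr (_ `^ _)%R; field.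
Qed.

(** For $p > 1$ the condition on $\beta$ says that $\beta q > m$, where $q$ is
    the conjugate exponent; for $p = 1$ it makes $w_n^\beta \le 1$. *)
Lemma dual_norm_elevation_lty p x (G : 'rV[R]_m -> R) (a : R) :
  1 <= p -> (m%:R * conj_ratio p < beta)%R -> (0 < x ord0 ord_max)%R ->
  measurable_fun setT G -> (0 <= a)%R ->
  (forall y, `|G y| <= a * elevation x y `^ beta)%R ->
  dual_norm p G < +oo.
Proof.
move=> p1 hb x0 mG a0 Ga.
have e0 y := ltW (elevation_gt0 y x0).
have mp (s : R) : measurable_fun setT (fun y => (elevation x y `^ s)%:E).
  apply/measurable_EFinP.
  exact: (measurable_powR_comp _ (measurable_elevation x)).
have mG' : measurable_fun setT (fun y => `|G y|%R) by exact: measurableT_comp.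
have p0 s y : 0 <= (elevation x y `^ s)%:E by rewrite lee_fin powR_ge0.
case: p p1 hb => [r|_|//]; rewrite /dual_norm /conj_ratio; last first.
  rewrite mulr1 => hb.
  apply: (@le_lt_trans _ _ (\int[mu]_y (a%:E * (elevation x y `^ beta)%:E))).
    apply: ge0_le_integral => //.
    - exact/measurable_EFinP.
    - exact: measurable_funeM.
    - by move=> y _; rewrite -EFinM lee_fin.
  rewrite (ge0_integralZl _ measurableT (mp beta) (fun y _ => p0 _ y))
    ?lee_fin//.
  by rewrite lte_mul_pinfty// integral_elevation_lty.
rewrite lee_fin => r1' hb.
case: eqVneq => [r1|r1].
  rewrite r1 subrr mul0r mulr0 in hb.
  apply: (@le_lt_trans _ _ a%:E); last exact: ltry.
  apply: ge_ereal_sup => _ [y _ <-].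
  rewrite lee_fin (le_trans (Ga y))// ler_piMr//.
  apply: (@le_trans _ _ (1 `^ beta)%R); last by rewrite powR1.
  apply: ge0_ler_powR; rewrite ?nnegrE ?(ltW hb)//.
  exact: elevation_le1.
have {r1 r1'} r1 : (1 < r)%R by rewrite lt_neqAle eq_sym r1.
have r0 : (0 < r)%R by exact: lt_trans r1.
have r10 : (0 < r - 1)%R by rewrite subr_gt0.
set q := (r / (r - 1))%R.
have q0 : (0 < q)%R by rewrite divr_gt0.
apply: poweR_lty.
apply: (@le_lt_trans _ _
  (\int[mu]_y ((a `^ q)%:E * (elevation x y `^ (beta * q))%:E))).
  apply: ge0_le_integral => //.
  - by apply/measurable_EFinP; exact: measurable_powR_comp.
  - exact: measurable_funeM.
  - move=> y _; rewrite -EFinM lee_fin powRrM -powRM ?powR_ge0//.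
    by apply: ge0_ler_powR; rewrite ?nnegrE ?(ltW q0) ?mulr_ge0 ?powR_ge0.
rewrite (ge0_integralZl _ measurableT (mp (beta * q)%R) (fun y _ => p0 _ y))
  ?lee_fin ?powR_ge0//.
rewrite lte_mul_pinfty ?lee_fin ?powR_ge0// integral_elevation_lty//.
by rewrite -ltr_pdivrMr// /q invf_div.
Qed.

Lemma norm_kernelE x z y : (`|kernel alpha beta x z y| =
  angular alpha (sight x y) z * dot (sight x y) (e_n R m) `^ beta)%R.
Proof. by rewrite /kernel normrM ger0_norm ?powR_ge0// mulrC. Qed.

Lemma measurable_angular z : measurable_fun setT (angular alpha ^~ z).
Proof.
rewrite (_ : angular alpha ^~ z = (fun w : 'rV[R]_m.+1 =>
    `|alpha * dot (e_n R m) z - dot w (e_n R m) * dot w z|%R)); last first.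
  by apply/funext => w; rewrite /angular dotBl !dotZl.
apply: measurableT_comp => //; apply: measurable_funB => //.
by apply: measurable_funM; exact: measurable_dot.
Qed.

Lemma sight_hemisphere x y : (0 < x ord0 ord_max)%R -> hemisphere (sight x y).
Proof.
move=> x0; split; first exact: enorm_sight.
by have := elevation_gt0 y x0; rewrite /elevation /e_n dot_delta.
Qed.

Lemma hemisphere_sight x w : (0 < x ord0 ord_max)%R -> hemisphere w ->
  exists y, sight x y = w.
Proof.
move=> x0 [w1 w0].
exists ((unsnoc x).1 +
  (- x ord0 ord_max) *: ((w ord0 ord_max)^-1 *: (unsnoc w).1))%R.
rewrite sight_affine//.
have -> : snoc ((w ord0 ord_max)^-1 *: (unsnoc w).1, 1%R)%R =
    ((w ord0 ord_max)^-1 *: w)%R.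
  rewrite -[1%R](mulVf (lt0r_neq0 w0)) snocZ; congr (_ *: _)%R.
  exact: (unsnocK w).
rewrite directionZ ?invr_gt0// /direction (_ : enorm w = 1%R) ?invr1 ?scale1r//.
Qed.

(** The supremum, or the integral over the hyperplane, is transported to the
    hemisphere. The power of the height is the Jacobian factor $x_n^m$ raised to
    $1/q = (p - 1)/p$. *)
Lemma dual_norm_kernel (k : R) p x z : 1 <= p -> (0 < x ord0 ord_max)%R ->
  (`|k| * beta)%:E * dual_norm p (kernel alpha beta x z) =
  (x ord0 ord_max `^ (m%:R * conj_ratio p))%:E * coef alpha beta k p z.
Proof.
move=> p1 x0.
have xm0 : (0 <= x ord0 ord_max ^+ m)%R by rewrite exprn_ge0// ltW.
rewrite /coef muleCA; congr (_ * _).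
case: p p1 => [r|_|//]; rewrite /dual_norm /conj_ratio.
  case: eqVneq => [-> _|r1].
    rewrite subrr mul0r mulr0 powRr0 mul1e; congr ereal_sup.
    apply/seteqP; split => [_ [y _ <-]|_ [w wS <-]].
      by exists (sight x y); [exact: sight_hemisphere|rewrite norm_kernelE].
    have [y yw] := hemisphere_sight x0 wS; exists y => //.
    by rewrite norm_kernelE yw.
  rewrite lee_fin => r1'.
  have {r1 r1'} r1 : (1 < r)%R by rewrite lt_neqAle eq_sym r1.
  have r0 : (0 < r)%R by exact: lt_trans r1.
  have r10 : (0 < r - 1)%R by rewrite subr_gt0.
  set q := (r / (r - 1))%R.
  pose f (w : 'rV[R]_m.+1) :=
    ((angular alpha w z * dot w (e_n R m) `^ beta) `^ q)%:E.
  have mf : measurable_fun setT f.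
    apply/measurable_EFinP/measurable_powR_comp/measurable_funM.
      exact: measurable_angular.
    exact: (measurable_powR_comp _ (measurable_dot _)).
  have f0 w : 0 <= f w by rewrite lee_fin powR_ge0.
  have -> : \int[mu]_y (`|kernel alpha beta x z y| `^ q)%:E =
      \int[mu]_y f (sight x y).
    by apply: eq_integral => y _; rewrite norm_kernelE.
  rewrite (ge0_integral_sight_sphere x0 mf f0).
  set J := (X in (_ * X) `^ _).
  have J0 : 0 <= J.
    by apply: integral_ge0 => w _; rewrite mule_ge0// lee_fin powR_ge0.
  have -> : J = \int[@sphere_measure R m.+1]_(w in @hemisphere R m)
      (angular alpha w z `^ q * dot w (e_n R m) `^
        (((beta - m.+1%:R) * r + m.+1%:R) / (r - 1)))%:E.
    apply: eq_integral => w /set_mem [w1 w0].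
    have wn : (0 < dot w (e_n R m))%R by rewrite /e_n dot_delta.
    rewrite /f -EFinM powRM ?powR_ge0 ?normr_ge0//.
    rewrite -mulrA -powRrM -powRD; last first.
      by rewrite (gt_eqF wn) implybT.
    by congr (_ * _ `^ _)%R%:E; rewrite /q; field; rewrite gt_eqF.
  rewrite poweRM; [|by rewrite lee_fin|].
    by rewrite poweR_EFin [in RHS]powRrM powR_mulrn// ltW.
  by apply: integral_ge0 => w _; rewrite lee_fin mulr_ge0// powR_ge0.
pose f (w : 'rV[R]_m.+1) := (angular alpha w z * dot w (e_n R m) `^ beta)%:E.
have mf : measurable_fun setT f.
  apply/measurable_EFinP/measurable_funM.
    exact: measurable_angular.
  exact: (measurable_powR_comp _ (measurable_dot _)).
have f0 w : 0 <= f w by rewrite lee_fin mulr_ge0 ?powR_ge0 ?normr_ge0.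
have -> : \int[mu]_y `|kernel alpha beta x z y|%:E = \int[mu]_y f (sight x y).
  by apply: eq_integral => y _; rewrite norm_kernelE.
rewrite (ge0_integral_sight_sphere x0 mf f0); congr (_ * _).
  by rewrite mulr1 powR_mulrn// ltW.
apply: eq_integral => w /set_mem [w1 w0].
have wn : (0 < dot w (e_n R m))%R by rewrite /e_n dot_delta.
rewrite /f -EFinM -mulrA -powRD//.
by rewrite (gt_eqF wn) implybT.
Qed.

End kernel_norm.

(** * The gradient of the potential *)

Section integrability.
Context {R : realType} {m : nat}.
Variables (alpha beta : R) (p : \bar R).
Hypotheses (halpha : 0 <= alpha) (hp : (1 <= p)%E)
  (hbeta : m%:R * conj_ratio p < beta).
Implicit Types (x z : 'rV[R]_m.+1) (y : 'rV[R]_m) (f : 'rV[R]_m -> R).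
Local Notation mu := (lebesgue_rV R m).

Lemma conj_ratio_ge0 : 0 <= conj_ratio p.
Proof.
case: p hp => [r|_|//] /=; last exact: ler01.
rewrite lee_fin => r1; rewrite divr_ge0 ?subr_ge0//.
exact: le_trans r1.
Qed.

Lemma beta_gt0 : 0 < beta.
Proof. by rewrite (le_lt_trans _ hbeta)// mulr_ge0// conj_ratio_ge0. Qed.

Lemma integrable_elevation x f : 0 < x ord0 ord_max -> f \in Lfun mu p ->
  mu.-integrable setT (EFin \o (fun y => elevation x y `^ beta * f y)).
Proof.
move=> x0; apply: integrable_pairing => //.
  exact: (measurable_powR_comp _ (measurable_elevation x)).
apply: (dual_norm_elevation_lty (x := x) (a := 1)) => //.
- exact: hbeta.
- exact: (measurable_powR_comp _ (measurable_elevation x)).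
- by move=> y; rewrite mul1r ger0_norm// powR_ge0.
Qed.

Lemma kernel_dual_norm_lty x z : 0 < x ord0 ord_max -> enorm z <= 1 ->
  (dual_norm p (kernel alpha beta x z) < +oo)%E.
Proof.
move=> x0 z1; apply: (dual_norm_elevation_lty (x := x) (a := alpha + 1)) => //.
- exact: hbeta.
- exact: measurable_kernel.
- by rewrite addr_ge0.
- by move=> y; exact: norm_kernel_le.
Qed.

Lemma integrable_kernel x z f : 0 < x ord0 ord_max -> enorm z <= 1 ->
  f \in Lfun mu p ->
  mu.-integrable setT (EFin \o (fun y => kernel alpha beta x z y * f y)).
Proof.
move=> x0 z1; apply: integrable_pairing => //; first exact: measurable_kernel.
exact: kernel_dual_norm_lty.
Qed.

Lemma integrable_integrand x f : 0 < x ord0 ord_max -> f \in Lfun mu p ->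
  mu.-integrable setT (EFin \o integrand alpha beta f x).
Proof.
move=> x0 fL; rewrite (_ : _ \o _ = (fun y =>
    (x ord0 ord_max `^ (beta * (alpha - 1)))%:E *
    (elevation x y `^ beta * f y)%:E)%E); last first.
  by apply/funext => y; rewrite /= integrandE// EFinM.
by apply: integrableZl => //; exact: integrable_elevation.
Qed.

End integrability.

(** A power function is monotone, increasing or decreasing according to the
    sign of the exponent, hence below the sum of its values at the ends. *)
Lemma powR_le_ends (R : realType) (a b t c : R) : 0 < a -> a <= t -> t <= b ->
  t `^ c <= a `^ c + b `^ c.
Proof.
move=> a0 at_ tb; have t0 := lt_le_trans a0 at_; have b0 := lt_le_trans t0 tb.
have [c0|c0] := leP 0 c.
  apply: (@le_trans _ _ (b `^ c)); last by rewrite lerDr powR_ge0.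
  by apply: ge0_ler_powR => //; rewrite nnegrE ltW.
apply: (@le_trans _ _ (a `^ c)); last by rewrite lerDl powR_ge0.
rewrite -[c]opprK [in leLHS]powRN [in leRHS]powRN.
rewrite lef_pV2 ?posrE ?powR_gt0//; apply: ge0_ler_powR => //.
- by rewrite oppr_ge0 ltW.
- by rewrite nnegrE ltW.
- by rewrite nnegrE ltW.
Qed.

Section gradient.
Context {R : realType} {m : nat}.
Variables (alpha beta k : R) (p : \bar R).
Hypotheses (halpha : 0 <= alpha) (hp : (1 <= p)%E)
  (hbeta : m%:R * conj_ratio p < beta).
Implicit Types (x z v w : 'rV[R]_m.+1) (y : 'rV[R]_m) (f : 'rV[R]_m -> R).
Local Notation mu := (lebesgue_rV R m).
Local Notation gamma := (beta * (alpha - 1) - 1).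

(** Moving $x$ by at most $x_n / 2$ raises it to at most $3 x_n / 2$ and at most
    halves its distance to any boundary point, since that distance stays at
    least the new height, which is at least $x_n / 2$. *)
Lemma elevation_translate x v y t : enorm v = 1 -> 0 < x ord0 ord_max ->
  `|t| <= x ord0 ord_max / 2 ->
  elevation (t *: v + x) y <= 3 * elevation x y.
Proof.
move=> v1 x0 tx.
have tv : `|t * v ord0 ord_max| <= x ord0 ord_max / 2.
  rewrite normrM (le_trans _ tx)// ler_piMr//.
  by rewrite -v1; exact: ler_coord_enorm.
have Xt : (t *: v + x) ord0 ord_max = t * v ord0 ord_max + x ord0 ord_max.
  by rewrite !mxE.
have := dist_ge_height (t *: v + x) y.
have := enorm_translate (x - snoc (y, 0)) t v1; rewrite addrA => rt.
have r0 := dist_gt0 y x0.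
rewrite !elevationE Xt.
have xt0 : 0 < t * v ord0 ord_max + x ord0 ord_max.
  by move: tv; rewrite ler_norml => /andP[]; lra.
rewrite ger0_norm ?(ltW xt0)// => rt'.
rewrite mulrA ler_pdivrMr; last exact: lt_le_trans rt'.
rewrite mulrAC ler_pdivlMr//.
have tv0 : - (x ord0 ord_max / 2) <= t * v ord0 ord_max.
  by move: tv; rewrite ler_norml => /andP[].
move: tv; rewrite ler_norml => /andP[_ tv].
have h1 : t * v ord0 ord_max + x ord0 ord_max <= 3 / 2 * x ord0 ord_max by lra.
apply: (@le_trans _ _ ((3 / 2 * x ord0 ord_max) * enorm (x - snoc (y, 0)))).
  by rewrite ler_wpM2r// ltW.
have h2 : enorm (x - snoc (y, 0)) <= 2 * enorm (t *: v + x - snoc (y, 0)).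
  have : x ord0 ord_max <= 2 * (t * v ord0 ord_max + x ord0 ord_max).
    by move: tv0; lra.
  move: rt rt' tx; set a := enorm _; set b := enorm _; lra.
nra.
Qed.

(** Differentiation under the integral sign, dominated by a multiple of
    $w_n^\beta |f|$ at the centre $x$. *)
Lemma derivable_potential f x v : f \in Lfun mu p -> 0 < x ord0 ord_max ->
  enorm v = 1 ->
  derivable (potential alpha beta k f) x v /\
  'D_v (potential alpha beta k f) x = k * (beta * x ord0 ord_max `^ gamma) *
    \int[mu]_y (kernel alpha beta x v y * f y).
Proof.
move=> fL x0 v1; set X := x ord0 ord_max in x0 *.
have X2 : 0 < X / 2 by rewrite divr_gt0.
have b0 := beta_gt0 hp hbeta.
pose J (t : R) y := integrand alpha beta f (t *: v + x) y.
have Xt t : (t *: v + x) ord0 ord_max = t * v ord0 ord_max + X by rewrite !mxE.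
have Itv t : `](- (X / 2)), (X / 2)[%classic t -> `|t| <= X / 2.
  by rewrite /= in_itv/= => /andP[t1 t2]; rewrite ler_norml !ltW.
have Xend t : `|t| <= X / 2 ->
    X / 2 <= (t *: v + x) ord0 ord_max /\
    (t *: v + x) ord0 ord_max <= 3 / 2 * X.
  move=> tX; have : `|t * v ord0 ord_max| <= X / 2.
    rewrite normrM (le_trans _ tX)// ler_piMr//.
    by rewrite -v1; exact: ler_coord_enorm.
  by rewrite Xt ler_norml => /andP[]; lra.
have Xt0 t : `|t| <= X / 2 -> 0 < (t *: v + x) ord0 ord_max.
  by move=> /Xend[] + _; exact: lt_le_trans.
have dJ t y : `](- (X / 2)), (X / 2)[%classic t -> is_derive t 1 (J ^~ y)
    (beta * (t *: v + x) ord0 ord_max `^ gamma *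
     (kernel alpha beta (t *: v + x) v y * f y)).
  by move=> /Itv /Xt0 tx; exact: is_derive_integrand.
(* M bounds the power of the height, whatever the sign of gamma; G dominates the
   derivatives *)
pose M := (X / 2) `^ gamma + (3 / 2 * X) `^ gamma.
pose G y := beta * M * (alpha + 1) * 3 `^ beta * `|elevation x y `^ beta * f y|.
have M0 : 0 <= M by rewrite addr_ge0 ?powR_ge0.
have I0 : `](- (X / 2)), (X / 2)[%classic 0 by rewrite /= in_itv/= oppr_lt0 X2.
have iG : mu.-integrable setT (EFin \o G).
  rewrite (_ : _ \o _ = (fun y => (beta * M * (alpha + 1) * 3 `^ beta)%:E *
     `|(elevation x y `^ beta * f y)%:E|)%E)//.
  apply: integrableZl => //.
  exact: (integrable_abse (integrable_elevation hp hbeta x0 fL)).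
have G0 y : 0 <= G y.
  by rewrite /G !mulr_ge0 ?powR_ge0 ?M0 ?(ltW b0) ?(addr_ge0 halpha).
have GJ t y : `](- (X / 2)), (X / 2)[%classic t -> setT y ->
    `|partial1of2 J t y| <= G y.
  move=> tI _; rewrite partial1of2E (@derive_val _ _ _ _ _ _ _ (dJ t y tI)).
  have tX := Itv _ tI; have [Xl Xr] := Xend _ tX; have xt0 := Xt0 _ tX.
  have e0 := elevation_gt0 y x0.
  have kb : `|kernel alpha beta (t *: v + x) v y| <=
      (alpha + 1) * (3 `^ beta * elevation x y `^ beta).
    apply: (le_trans (norm_kernel_le beta y halpha xt0 _)); first by rewrite v1.
    rewrite ler_wpM2l ?addr_ge0// -powRM ?(ltW e0)//.
    apply: ge0_ler_powR; rewrite ?nnegrE ?(ltW b0)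
      ?(ltW (elevation_gt0 y xt0)) ?mulr_ge0 ?(ltW e0)//.
    exact: elevation_translate.
  have xM := powR_le_ends gamma X2 Xl Xr.
  have -> : G y = beta * (M * ((alpha + 1) *
      (3 `^ beta * elevation x y `^ beta)) * `|f y|).
    by rewrite /G normrM (ger0_norm (powR_ge0 (elevation x y) _)); ring.
  rewrite normrM (normrM beta) (normrM (kernel _ _ _ _ _)).
  rewrite (ger0_norm (ltW b0)) -mulrA ler_wpM2l ?(ltW b0)//.
  rewrite (ger0_norm (powR_ge0 _ _)) mulrA ler_wpM2r//.
  exact: (ler_pM (powR_ge0 _ _) (normr_ge0 _) xM kb).
have cJ := @cvg_differentiation_under_integral R _ _ mu J setT measurableT 0
  (- (X / 2)) (X / 2) I0
  (fun t tI => integrable_integrand alpha hp hbeta (Xt0 _ (Itv _ tI)) fL)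
  (fun t y tI _ => @ex_derive _ _ _ _ _ _ _ (dJ t y tI)) G G0 iG GJ.
have cu : h^-1 *: ((potential alpha beta k f \o shift x) (h *: v) -
    potential alpha beta k f x) @[h --> 0^'] -->
    k * (beta * X `^ gamma) * \int[mu]_y (kernel alpha beta x v y * f y).
  have -> : k * (beta * X `^ gamma) * \int[mu]_y (kernel alpha beta x v y * f y)
      = k * \int[mu]_y partial1of2 J 0 y.
    rewrite -mulrA; congr (_ * _); rewrite -RintegralZl//; last first.
      by apply: (integrable_kernel halpha hp hbeta) => //; rewrite v1.
    apply: eq_Rintegral => y _.
    rewrite partial1of2E (@derive_val _ _ _ _ _ _ _ (dJ 0 y I0)).
    by rewrite scale0r add0r.
  have -> : (fun h => h^-1 *: ((potential alpha beta k f \o shift x) (h *: v) -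
      potential alpha beta k f x)) = (fun h : R => k * (h^-1 *:
      (\int[mu]_y J (h + 0) y - \int[mu]_y J 0 y))).
    apply/funext => h; rewrite /potential /J addr0 scale0r add0r /=.
    by rewrite -mulrBr scalerAr.
  by apply: cvgMr; exact: cJ.
split; first by apply/cvg_ex; eexists; exact: cu.
exact/cvg_lim/cu.
Qed.

Lemma gradient_potential f x z : f \in Lfun mu p -> 0 < x ord0 ord_max ->
  enorm z = 1 ->
  dot (gradient (potential alpha beta k f) x) z =
  k * (beta * x ord0 ord_max `^ gamma) *
    \int[mu]_y (kernel alpha beta x z y * f y).
Proof.
move=> fL x0 z1.
have iK i : mu.-integrable setT
   (EFin \o (fun y => kernel alpha beta x (delta_mx ord0 i) y * f y)).
  by apply: (integrable_kernel halpha hp hbeta) => //; rewrite enorm_delta.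
transitivity (\sum_i z ord0 i * (k * (beta * x ord0 ord_max `^ gamma) *
    \int[mu]_y (kernel alpha beta x (delta_mx ord0 i) y * f y))).
  apply: eq_bigr => i _; rewrite mxE mulrC; congr (_ * _).
  by have [_ ->] := derivable_potential fL x0 (enorm_delta i).
rewrite -[RHS]mulr1; under eq_bigr do rewrite mulrCA.
rewrite -mulr_sumr mulr1; congr (_ * _).
apply: EFin_inj; rewrite -sumEFin.
rewrite {2}/Rintegral fineK; last first.
  apply: integrable_fin_num => //.
  by apply: (integrable_kernel halpha hp hbeta) => //; rewrite z1.
rewrite [RHS](_ : _ = (\int[mu]_y \sum_(i < m.+1) (z ord0 i)%:E *
    (kernel alpha beta x (delta_mx ord0 i) y * f y)%:E)%E); last first.
  apply: eq_integral => y _; rewrite kernel_sum mulr_suml -sumEFin.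
  apply: eq_bigr => i _; rewrite -EFinM; congr (_%:E).
  exact: esym (mulrA _ _ _).
rewrite integral_sum//; last by move=> i; apply: integrableZl => //; exact: iK.
apply: eq_bigr => i _; rewrite integralZl//; last exact: iK.
by rewrite EFinM /Rintegral fineK//; apply: integrable_fin_num => //; exact: iK.
Qed.

End gradient.

Lemma conj_ratioE (R : realType) (p : \bar R) : (1 <= p)%E ->
  conj_ratio p = 1 - inv_exponent p.
Proof.
case: p => [r|_|//] /=; last by rewrite subr0.
rewrite lee_fin => r1; have r0 : 0 < r by exact: lt_le_trans r1.
by rewrite mulrBl mulfV ?gt_eqF// mul1r.
Qed.

Theorem proposition1 (R : realType) (m : nat) (p : \bar R) (alpha beta k : R)
    (hn : (3 <= m.+1)%N) (hp : (1 <= p)%E) (halpha : 0 <= alpha)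
    (hbeta : m%:R * conj_ratio p < beta)
    (x : 'rV[R]_m.+1) (hx : 0 < x ord0 ord_max) :
  [/\ forall f : 'rV[R]_m -> R, f \in Lfun (lebesgue_rV R m) p ->
        (lebesgue_rV R m).-integrable setT
          (EFin \o integrand alpha beta f x) /\
        forall i : 'I_m.+1,
          derivable (potential alpha beta k f) x (delta_mx ord0 i),
      forall z : 'rV[R]_m.+1, enorm z = 1 ->
        is_sharp_coefficient p
          (fun f => `|dot (gradient (potential alpha beta k f) x) z|)
          (coef alpha beta k p z /
             (x ord0 ord_max `^ height_exponent m alpha beta p)%:E)%E
    & is_sharp_coefficient p
        (fun f => enorm (gradient (potential alpha beta k f) x))
        (ereal_sup [set coef alpha beta k p z | z in @esphere R m.+1] /
           (x ord0 ord_max `^ height_exponent m alpha beta p)%:E)%E ].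
Proof.
have b0 := beta_gt0 hp hbeta.
set X := x ord0 ord_max in hx *.
set h := height_exponent m alpha beta p.
have Xh0 : 0 < X `^ (- h) by exact: powR_gt0.
have divE (C : \bar R) : (C / (X `^ h)%:E = (X `^ (- h))%:E * C)%E.
  by rewrite inver gt_eqF ?powR_gt0// powRN muleC.
have sharp_z z : enorm z = 1 -> is_sharp_coefficient p
    (fun f => `|dot (gradient (potential alpha beta k f) x) z|)
    ((X `^ (- h))%:E * coef alpha beta k p z)%E.
  move=> z1; pose a := `|k| * (beta * X `^ (beta * (alpha - 1) - 1)).
  have a0 : 0 <= a by rewrite !mulr_ge0 ?powR_ge0// ltW.
  apply: (@is_sharp_coefficient_eq _ _ _
      (fun f => a * pairing (kernel alpha beta x z) f)).
    move=> f fL; rewrite (gradient_potential k halpha hp hbeta fL hx z1).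
    rewrite !normrM (ger0_norm (ltW b0)) (ger0_norm (powR_ge0 _ _)) -/X.
    by [].
  have -> : ((X `^ (- h))%:E * coef alpha beta k p z =
      a%:E * dual_norm p (kernel alpha beta x z))%E.
    rewrite /a mulrA [in RHS]mulrC EFinM -muleA dual_norm_kernel//.
    rewrite [in RHS]muleA -EFinM.
    rewrite -powRD; last by rewrite (gt_eqF hx) implybT.
    congr ((_ `^ _)%:E * _)%E.
    by rewrite /h /height_exponent conj_ratioE// -natr1; ring.
  apply: is_sharp_coefficientZ => //.
    by move=> f; exact: normr_ge0.
  apply: pairing_sharp => //.
  - exact: measurable_kernel.
  - exact: continuous_kernel.
  - by apply: (kernel_dual_norm_lty halpha hp hbeta) => //; rewrite z1.
split.
- move=> f fL; split; first exact: (integrable_integrand alpha hp hbeta hx fL).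
  move=> i.
  by have [] := derivable_potential k halpha hp hbeta fL hx (enorm_delta i).
- by move=> z z1; rewrite divE; exact: sharp_z.
- rewrite divE -ereal_sup_pZl// image_comp.
  exact: (is_sharp_coefficient_enorm hp sharp_z).
Qed.
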